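(* Let $V_1,V_2,V_3$ be irreducible, admissible, infinite-dimensional representations of $G=\mathrm{GL}_2(F)$ with central characters satisfying $\omega_1\omega_2\omega_3=1$, with conductors $n_1,n_2,n_3$ and new vectors $v_1,v_2,v_3$. Assume that $V_1$ and $V_2$ are principal series, $V_i=\mathrm{Ind}_B^G\chi_i$ with $\chi_i\begin{pmatrix}a&b\\0&d\end{pmatrix}=\mu_i(a)\mu_i'(d)$ and $\mu_i'\mu_i^{-1}\neq|\cdot|^{\pm1}$ ($i=1,2$). Put $m_i=\mathrm{cond}(\mu_i')$, $\alpha_i^{-1}=\mu_i(\pi)|\pi|^{1/2}$ and $\beta_i^{-1}=\mu_i'(\pi)|\pi|^{-1/2}$ for $i=1,2$. Suppose that $\mu_1$ or $\mu_2'$ is ramified. Let $x,y,z$ be integers such that - $x\ge m_1$, - $y\ge m_2$, - $x-n_3\ge z\ge y$, and - $x-y\ge\max(n_1-m_1,\,n_2-m_2,\,1)$. Put $$v_1^*=\begin{cases}\gamma^{x-m_1}\cdot v_1&\text{if }\mu_1'\text{ is ramified},\\ \gamma^{x}\cdot v_1-\beta_1\gamma^{x-1}\cdot v_1&\text{if }\mu_1'\text{ is unramified},\end{cases}\qquad v_2^*=\begin{cases}\gamma^{y-m_2}\cdot v_2&\text{if }\mu_2\text{ is ramified},\\ \gamma^{y-n_2}\cdot v_2-\alpha_2^{-1}\gamma^{y-n_2+1}\cdot v_2&\text{if }\mu_2\text{ is unramified}.\end{cases}$$ Then, for $\ell$ a non-zero $G$-invariant linear form on $V_1\otimes V_2\otimes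 V_3$, $$\ell(v_1^*\otimes v_2^*\otimes\gamma^z\cdot v_3)=0.$$
   Context: $F$ is a finite extension of $\mathbb{Q}_p$ with ring of integers $\mathcal{O}$, uniformizer $\pi$ and normalised absolute value $|\cdot|$; $G=\mathrm{GL}_2(F)$, $K=\mathrm{GL}_2(\mathcal{O})$, $\gamma=\begin{pmatrix}\pi^{-1}&0\\0&1\end{pmatrix}$. For $n\ge 1$, $I_n=\begin{pmatrix}\mathcal{O}^\times&\mathcal{O}\\ \pi^n\mathcal{O}&\mathcal{O}^\times\end{pmatrix}$, and $I_0=K$. $B$ is the subgroup of upper triangular matrices and $\delta\begin{pmatrix}a&b\\0&d\end{pmatrix}=|a/d|$. For a quasi-character $\chi$ of $B$ (trivial on unipotents), $\mathrm{Ind}_B^G\chi$ is the normalised induction: the space of functions $f:G\to\mathbb{C}$, right-invariant under some open compact subgroup, with $f(bg)=\delta(b)^{1/2}\chi(b)f(g)$ for $b\in B$, $g\in G$, on which $G$ acts by right translation. The $\mu_i,\mu_i'$ are quasi-characters of $F^\times$; $\mathrm{cond}(\mu)$ is the exponent of the conductor of $\mu$ ($0$ if $\mu$ is trivial on $\mathcal{O}^\times$, i.e. unramified; otherwise the least $n\ge1$ with $\mu$ trivial on $1+\pi^n\mathcal{O}$). Let $V$ be an irreducible, admissible, infinite-dimensional representation of $G$ with central character $\omega$. Put $V^{I_0,\omega}=V^K$ and, for $n\ge1$, $V^{I_n,\omega}=\{v\in V: \begin{pmatrix}a&b\\c&d\end{pmatrix}\cdot v=\omega(d)v \text{ for all }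 \begin{pmatrix}a&b\\c&d\end{pmatrix}\in I_n\}$. The conductor of $V$ is the minimal $n\ge 0$ such that $V^{I_n,\omega}\neq 0$; for this $n$ the space is one-dimensional and any non-zero vector in it is called a new vector of $V$. One has $n_i=\mathrm{cond}(\mu_i)+\mathrm{cond}(\mu_i')$ for $i=1,2$. It is a known theorem of Prasad that, when $V_1,V_2$ are principal series and $\omega_1\omega_2\omega_3=1$, the space of $G$-invariant linear forms on $V_1\otimes V_2\otimes V_3$ (diagonal action) is one-dimensional. *)

(* Defs.v *)
From HB Require Import structures.
From mathcomp Require Import all_boot all_order all_algebra all_field.
From mathcomp Require Import boolp classical_sets functions cardinality reals.
From mathcomp Require Import complex.

Set Implicit Arguments.
Unset Strict Implicit.
Unset Printing Implicit Defensive.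

Import Order.TTheory GRing.Theory Num.Theory.

Local Open Scope classical_set_scope.
Local Open Scope ring_scope.
Local Open Scope complex_scope.

Record nonarch_abs (R : realType) (K : fieldType) (a : K -> R) : Prop :=
  NonarchAbs {
    nonarch_abs_ge0 : forall x, 0 <= a x;
    nonarch_abs_eq0 : forall x, a x = 0 <-> x = 0;
    nonarch_absM : forall x y, a (x * y) = a x * a y;
    nonarch_absD : forall x y, a (x + y) <= Num.max (a x) (a y) }.

Definition padic_abs (R : realType) (p : nat) (r : rat) : R :=
  if r == 0 then 0
  else p%:R ^+ logn p `|denq r|%N / p%:R ^+ logn p `|numq r|%N.

(* (K, a) is the completion of the rationals for the p-adic absolute value;
   this determines it up to a unique isometric isomorphism. *)
Record is_Qp (R : realType) (p : nat) (K : fieldType) (a : K -> R) : Prop :=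
  IsQp {
    Qp_prime : prime p;
    Qp_abs : nonarch_abs a;
    Qp_ext : forall r : rat, a (ratr r) = padic_abs R p r;
    Qp_dense : forall (x : K) (e : R), 0 < e ->
      exists r : rat, a (x - ratr r) < e;
    Qp_complete : forall u : nat -> K,
      (forall e : R, 0 < e -> exists N : nat, forall m n : nat,
          (N <= m)%N -> (N <= n)%N -> a (u m - u n) < e) ->
      exists l : K, forall e : R, 0 < e -> exists N : nat, forall n : nat,
          (N <= n)%N -> a (u n - l) < e }.

Section Integers.
Variables (R : realType) (F : fieldType) (abs : F -> R).

Definition integer : set F := [set x | abs x <= 1].
Definition integer_unit : set F := [set x | abs x = 1].

Definition uniformizer (pi : F) : Prop :=
  [/\ pi != 0, abs pi < 1 &
      forall x, abs x < 1 -> exists2 y, integer y & x = pi * y].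

(* r is the reduction map onto the residue field, numbered by 'I_q. *)
Definition residue_card (q : nat) : Prop :=
  exists r : F -> 'I_q,
    (forall k : 'I_q, exists2 x, integer x & r x = k) /\
    (forall x y, integer x -> integer y -> (r x = r y <-> abs (x - y) < 1)).

Definition ideal_pow (pi : F) (n : nat) : set F :=
  [set x | exists2 y, integer y & x = pi ^+ n * y].

Definition unit_filtration (pi : F) (n : nat) : set F :=
  if n is 0%N then integer_unit else [set x | ideal_pow pi n (x - 1)].

End Integers.

(* abs is the absolute value of the finite extension F of Q_p which induces
   the p-adic topology on Q_p and takes the value 1/q at uniformizers, q being
   the cardinality of the residue field. *)
Definition normalised_abs (R : realType) (Qp : fieldType) (absp : Qp -> R)
    (F : fieldExtType Qp) (abs : F -> R) : Prop :=
  [/\ nonarch_abs abs,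
      forall x : Qp, abs (x%:A) <= 1 <-> absp x <= 1 &
      exists2 q : nat, residue_card abs q &
        forall pi, uniformizer abs pi -> abs pi = q%:R^-1].

Section Quasicharacters.
Variables (R : realType) (F : fieldType) (abs : F -> R).

(* The value of mu at 0 is irrelevant. *)
Record quasichar (mu : F -> R[i]) : Prop := Quasichar {
  quasichar1 : mu 1 = 1;
  quasicharM : forall x y, x != 0 -> y != 0 -> mu (x * y) = mu x * mu y;
  quasichar_cont : forall x, x != 0 -> forall e : R, 0 < e ->
    exists2 d : R, 0 < d & forall y, y != 0 -> abs (y - x) < d ->
      `|mu y - mu x| < e%:C }.

Definition trivial_on (A : set F) (mu : F -> R[i]) : Prop :=
  forall x, A x -> mu x = 1.

Definition unramified (mu : F -> R[i]) : Prop :=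
  trivial_on (integer_unit abs) mu.

Definition ramified (mu : F -> R[i]) : Prop := ~ unramified mu.

(* m is the exponent of the conductor of mu. *)
Definition is_cond (pi : F) (mu : F -> R[i]) (m : nat) : Prop :=
  trivial_on (unit_filtration abs pi m) mu /\
  forall k, (k < m)%N -> ~ trivial_on (unit_filtration abs pi k) mu.

Definition alpha (pi : F) (mu : F -> R[i]) : R[i] :=
  (mu pi * (Num.sqrt (abs pi))%:C)^-1.
Definition beta (pi : F) (mu' : F -> R[i]) : R[i] :=
  (mu' pi / (Num.sqrt (abs pi))%:C)^-1.

End Quasicharacters.

Section GL2.
Variable F : fieldType.

Record GL2 := MkGL2 { gl2_mx :> 'M[F]_2; gl2_unit : gl2_mx \in unitmx }.

HB.instance Definition _ := [isSub for gl2_mx].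
HB.instance Definition _ := [Choice of GL2 by <:].

Definition gl2_one : GL2 := MkGL2 (unitmx1 F 2).

Fact gl2_mul_subproof (g h : GL2) : gl2_mx g *m gl2_mx h \in unitmx.
Proof. by rewrite unitmx_mul !gl2_unit. Qed.
Definition gl2_mul (g h : GL2) : GL2 := MkGL2 (gl2_mul_subproof g h).

Fact gl2_inv_subproof (g : GL2) : invmx (gl2_mx g) \in unitmx.
Proof. by rewrite unitmx_inv gl2_unit. Qed.
Definition gl2_inv (g : GL2) : GL2 := MkGL2 (gl2_inv_subproof g).

Fact gl2_mulA : associative gl2_mul.
Proof. by move=> g h k; apply: val_inj; rewrite /= mulmxA. Qed.
Fact gl2_mul1 : left_id gl2_one gl2_mul.
Proof. by move=> g; apply: val_inj; rewrite /= mul1mx. Qed.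
Fact gl2_mulr1 : right_id gl2_one gl2_mul.
Proof. by move=> g; apply: val_inj; rewrite /= mulmx1. Qed.
Fact gl2_mulV : left_inverse gl2_one gl2_inv gl2_mul.
Proof. by move=> g; apply: val_inj; rewrite /= mulVmx ?gl2_unit. Qed.
Fact gl2_mulrV : right_inverse gl2_one gl2_inv gl2_mul.
Proof. by move=> g; apply: val_inj; rewrite /= mulmxV ?gl2_unit. Qed.

HB.instance Definition _ :=
  isGroup.Build GL2 gl2_mulA gl2_mul1 gl2_mulr1 gl2_mulV gl2_mulrV.

Definition upper_triangular : set GL2 := [set b | b 1 0 = 0].

(* Here diag(pi^-1, 1) is invertible as soon as pi != 0; the default value 1
   of insubd is never used. *)
Definition gamma (pi : F) : GL2 :=
  insubd (1%g : GL2)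
    (\matrix_(i < 2, j < 2)
       (if i == j then (if i == 0 then pi^-1 else 1) else 0)).

End GL2.

Definition expgz (G : groupType) (g : G) (k : int) : G :=
  match k with
  | Posz n => (g ^+ n)%g
  | Negz n => (g ^- n.+1)%g
  end.

Section GL2Topology.
Variables (R : realType) (F : fieldType) (abs : F -> R).

(* The topology induced from the space of matrices. *)
Definition gl2_open (U : set (GL2 F)) : Prop :=
  forall g, U g -> exists2 e : R, 0 < e &
    forall h : GL2 F, (forall i j, abs (h i j - g i j) < e) -> U h.

Definition gl2_compact (A : set (GL2 F)) : Prop :=
  forall D : set (set (GL2 F)), (forall U, D U -> gl2_open U) ->
    A `<=` \bigcup_(U in D) U ->
    exists D' : set (set (GL2 F)),
      [/\ D' `<=` D, finite_set D' & A `<=` \bigcup_(U in D') U].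

Definition open_compact_subgroup (H : set (GL2 F)) : Prop :=
  [/\ H 1%g, forall g h, H g -> H h -> H (g * h)%g, forall g, H g -> H g^-1%g,
      gl2_open H & gl2_compact H].

Definition GL2_integer : set (GL2 F) :=
  [set g : GL2 F | forall i j, integer abs (g i j) /\ integer abs ((g^-1)%g i j)].

Definition I_ (pi : F) (n : nat) : set (GL2 F) :=
  if n is 0%N then GL2_integer
  else [set g : GL2 F | [/\ integer_unit abs (g 0 0), integer abs (g 0 1),
                    ideal_pow abs pi n (g 1 0) & integer_unit abs (g 1 1)]].

End GL2Topology.

Record gl2_rep (R : realType) (F : fieldType) := Gl2Rep {
  rep_space :> lmodType R[i];
  rep_act : GL2 F -> {linear rep_space -> rep_space};
  rep_act1 : forall v, rep_act 1%g v = v;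
  rep_actM : forall g h v, rep_act (g * h)%g v = rep_act g (rep_act h v) }.

Arguments rep_act {R F V} g : rename.

Section Representations.
Variables (R : realType) (F : fieldType) (abs : F -> R).
Implicit Types V : gl2_rep R F.

Definition finite_dim V (W : set V) : Prop :=
  exists s : seq V, forall v, W v ->
    exists c : nat -> R[i], v = \sum_(i < size s) c i *: s`_i.

Definition fixed_by V (H : set (GL2 F)) : set V :=
  [set v | forall g, H g -> rep_act g v = v].

Definition smooth V : Prop :=
  forall v : V, exists2 H, open_compact_subgroup abs H & fixed_by H v.

Definition admissible V : Prop :=
  smooth V /\
  forall H, open_compact_subgroup abs H -> finite_dim (@fixed_by V H).

Definition irreducible V : Prop :=
  (exists v : V, v != 0) /\
  forall W : set V,
    W 0 -> (forall (c : R[i]) v w, W v -> W w -> W (c *: v + w)) ->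
    (forall g v, W v -> W (rep_act g v)) ->
    W = [set 0] \/ W = [set: V].

Definition irr_adm_infdim V : Prop :=
  [/\ irreducible V, admissible V & ~ finite_dim [set: V]].

Definition central_character V (omega : F -> R[i]) : Prop :=
  forall (a : F) (g : GL2 F), gl2_mx g = a%:M ->
    forall v : V, rep_act g v = omega a *: v.

Definition I_eigenspace (pi : F) V (omega : F -> R[i]) (n : nat) : set V :=
  if n is 0%N then fixed_by (GL2_integer abs)
  else [set v | forall g, I_ abs pi n g -> rep_act g v = omega (g 1 1) *: v].

Definition is_conductor (pi : F) V (omega : F -> R[i]) (n : nat) : Prop :=
  (exists2 v : V, I_eigenspace pi omega n v & v != 0) /\
  forall k, (k < n)%N -> forall v : V, I_eigenspace pi omega k v -> v = 0.

Definition new_vector (pi : F) V (omega : F -> R[i]) (n : nat) (v : V) : Prop :=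
  [/\ is_conductor pi V omega n, I_eigenspace pi omega n v & v != 0].

(* The modulus |a/d| and the quasi-character mu(a) mu'(d) of the upper
   triangular subgroup, as functions on GL_2(F) that are only used there. *)
Definition delta (b : GL2 F) : R := abs (b 0 0 / b 1 1).
Definition chi (mu mu' : F -> R[i]) (b : GL2 F) : R[i] :=
  mu (b 0 0) * mu' (b 1 1).

Definition Ind (ch : GL2 F -> R[i]) : set (GL2 F -> R[i]) :=
  [set f | (exists2 H, open_compact_subgroup abs H &
              forall g h, H h -> f (g * h)%g = f g) /\
           (forall b g, upper_triangular b ->
              f (b * g)%g = (Num.sqrt (delta b))%:C * ch b * f g)].

(* V is Ind ch with G acting by right translation, through an equivariant
   linear bijection phi from V onto that space of functions. *)
Definition is_Ind V (ch : GL2 F -> R[i]) : Prop :=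
  exists phi : V -> GL2 F -> R[i],
    [/\ forall g, scalar (fun v => phi v g),
        injective phi,
        range phi = Ind ch &
        forall h v g, phi (rep_act h v) g = phi v (g * h)%g].

Definition principal_series V (mu mu' : F -> R[i]) : Prop :=
  [/\ quasichar abs mu, quasichar abs mu', is_Ind V (chi mu mu'),
      ~ (forall a, a != 0 -> mu' a / mu a = (abs a)%:C) &
      ~ (forall a, a != 0 -> mu' a / mu a = (abs a)%:C^-1)].

(* By the universal property, a linear form on the tensor product of V1, V2
   and V3 is a trilinear map. *)
Definition trilinear (V1 V2 V3 : gl2_rep R F) (l : V1 -> V2 -> V3 -> R[i]) :
    Prop :=
  [/\ forall v2 v3, scalar (fun v1 => l v1 v2 v3),
      forall v1 v3, scalar (fun v2 => l v1 v2 v3) &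
      forall v1 v2, scalar (fun v3 => l v1 v2 v3)].

Definition invariant_form (V1 V2 V3 : gl2_rep R F)
    (l : V1 -> V2 -> V3 -> R[i]) : Prop :=
  trilinear l /\
  forall g v1 v2 v3, l (rep_act g v1) (rep_act g v2) (rep_act g v3) = l v1 v2 v3.

Definition gammaz (pi : F) V (k : int) (v : V) : V :=
  rep_act (expgz (gamma pi) k) v.

Definition test_vector1 (pi : F) V (mu' : F -> R[i]) (m : nat) (x : int)
    (v : V) : V :=
  if `[< ramified abs mu' >] then gammaz pi (x - m%:Z) v
  else gammaz pi x v - beta abs pi mu' *: gammaz pi (x - 1) v.

Definition test_vector2 (pi : F) V (mu : F -> R[i]) (m n : nat) (y : int)
    (v : V) : V :=
  if `[< ramified abs mu >] then gammaz pi (y - m%:Z) v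
  else gammaz pi (y - n%:Z) v
       - (alpha abs pi mu)^-1 *: gammaz pi (y - n%:Z + 1) v.

End Representations.

(* Main.v *)
Require Import Defs.
From HB Require Import structures.
From mathcomp Require Import all_boot all_order all_algebra all_field.
From mathcomp Require Import boolp classical_sets functions cardinality reals.
From mathcomp Require Import complex.
From mathcomp Require Import zify ring lra.

(** A function of a principal series is determined by its values on the Borel
    orbit of the Weyl element and on the lower unipotent matrices
    [lower t], that is, by a locally constant function of [t] on the affine
    line with a prescribed behaviour at infinity. Write [w3] for the translate
    of [v3], [w1] and [w2] for the two test vectors, [P] for [abs pi].

    Seen this way, [w1] lives on the ball [abs t <= P ^ x]: it vanishes at the
    Weyl element and outside this ball ([test_vector1_supp]). Seen from the
    Weyl element, that is, after translation by it, [w2] lives on the ball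
    [abs t <= P ^ (- y)] if [mu2'] is ramified ([test_vector2_supp]). Moreover multiplying [t] by a
    unit multiplies both functions by a character of that unit: the inverse of
    [mu1] for [w1], [mu2'] for the translate of [w2].

    A locally constant function on a ball is a linear combination of translates,
    by points of this ball, of the indicator of one small ball around [0], a
    [cell]. Hence a linear form that is invariant under these translations maps
    the function to the value of the form at the cell times the sum of the
    values of the function on the small balls, and this sum vanishes when multiplication by units
    acts on the function through a non-trivial character ([collapse]).

    The inequalities between [x], [y], [z] and the conductors say that [w2] and
    [w3] are fixed by [lower c] for [abs c <= P ^ x], so that [collapse] applies
    to [w1] and the form [fun u => l u w2 w3]. If [mu1] is ramified the result is
    zero. In any case what remains is the value at [e, w2, w3], where [e] is a
    cell of arbitrarily small radius. A small cell is fixed by large upper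
    unipotents ([cell_exists]), in particular by [upper s] for
    [abs s <= P ^ (- y)], and so is [w3]. Thus [collapse] applies a second time, to the translate of [w2] by
    the Weyl element, and the result is zero if [mu2'] is ramified.

    The support of the test vectors comes from the invariance of the new
    vectors. When the relevant character is unramified, the linear combination
    of two translates is the one that kills the value at the Weyl element,
    respectively at the identity; invariance under unipotents then propagates
    the vanishing. When it is ramified, a non-zero value would force the
    character to be trivial on a group of units that is too large. For [w2] with
    [mu2] ramified this uses the minimality of the conductor, by way of an
    explicit eigenvector of smaller level ([ramified_near]). *)

Set Implicit Arguments.
Unset Strict Implicit.
Unset Printing Implicit Defensive.

Import Order.TTheory GRing.Theory Num.Theory.

Local Open Scope ring_scope.

(** * The absolute value *)

Section AbsoluteValue.
Variables (R : realType) (F : fieldType) (abs : F -> R).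
Hypothesis habs : nonarch_abs abs.

Lemma abs_ge0 x : 0 <= abs x. Proof. exact: nonarch_abs_ge0. Qed.

Lemma abs_eq0 x : (abs x == 0) = (x == 0).
Proof. by apply/eqP/eqP => /(nonarch_abs_eq0 habs). Qed.

Lemma abs_gt0 x : (0 < abs x) = (x != 0).
Proof. by rewrite lt_def abs_eq0 abs_ge0 andbT. Qed.

Lemma abs0 : abs 0 = 0. Proof. by apply/eqP; rewrite abs_eq0. Qed.

Lemma absM x y : abs (x * y) = abs x * abs y.
Proof. exact: nonarch_absM. Qed.

Lemma abs1 : abs 1 = 1.
Proof.
have /mulfI : abs 1 != 0 by rewrite abs_eq0 oner_eq0.
by apply; rewrite -absM !mulr1.
Qed.

Lemma absN x : abs (- x) = abs x.
Proof.
suff h : abs (-1) = 1 by rewrite -mulN1r absM h mul1r.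
have /eqP : abs (-1) ^+ 2 = 1 by rewrite expr2 -absM mulrNN mulr1 abs1.
rewrite sqrf_eq1 => /orP[/eqP //|/eqP h].
by have := abs_ge0 (-1); rewrite h oppr_ge0 ler10.
Qed.

Lemma absB x y : abs (x - y) = abs (y - x).
Proof. by rewrite -absN opprB. Qed.

Lemma absV x : abs x^-1 = (abs x)^-1.
Proof.
have [->|x0] := eqVneq x 0; first by rewrite invr0 abs0 invr0.
have ax0 : abs x != 0 by rewrite abs_eq0.
by apply: (mulfI ax0); rewrite -absM !divff // abs1.
Qed.

Lemma absf x y : abs (x / y) = abs x / abs y.
Proof. by rewrite absM absV. Qed.

Lemma absXz x (k : int) : abs (x ^ k) = abs x ^ k.
Proof.
have absX n : abs (x ^+ n) = abs x ^+ n.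
  by elim: n => [|n IH]; rewrite ?expr0 ?abs1 // !exprS absM IH.
by case: k => n; rewrite ?NegzE -?invr_expz -?exprnP ?absV absX.
Qed.

Lemma absD_le (r : R) x y : abs x <= r -> abs y <= r -> abs (x + y) <= r.
Proof.
by move=> hx hy; apply: le_trans (nonarch_absD habs x y) _; rewrite ge_max hx hy.
Qed.

Lemma absD_lt (r : R) x y : abs x < r -> abs y < r -> abs (x + y) < r.
Proof.
move=> hx hy; apply: le_lt_trans (nonarch_absD habs x y) _.
by rewrite gt_max hx hy.
Qed.

Lemma absB_le (r : R) x y : abs x <= r -> abs y <= r -> abs (x - y) <= r.
Proof. by move=> hx hy; apply: absD_le; rewrite ?absN. Qed.

Lemma absD_dom x y : abs y < abs x -> abs (x + y) = abs x.
Proof.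
move=> hyx; apply: le_anti; rewrite absD_le ?(ltW hyx) //= leNgt.
apply/negP => h; have : abs (x + y - y) < abs x by rewrite absD_lt ?absN.
by rewrite addrK ltxx.
Qed.

Lemma abs_near1 x : abs (x - 1) < 1 -> abs x = 1.
Proof.
move=> h; have -> : x = 1 + (x - 1) by rewrite addrC subrK.
by rewrite absD_dom abs1.
Qed.

Lemma unit_neq0 a : abs a = 1 -> a != 0.
Proof. by move=> a1; rewrite -abs_eq0 a1 oner_eq0. Qed.

End AbsoluteValue.

Section Uniformizer.
Variables (R : realType) (F : fieldType) (abs : F -> R).
Hypothesis habs : nonarch_abs abs.
Variable pi : F.
Hypothesis hpi : uniformizer abs pi.

Lemma unif_neq0 : pi != 0. Proof. by case: hpi. Qed.
Lemma abs_unif_gt0 : 0 < abs pi. Proof. by rewrite abs_gt0 // unif_neq0. Qed.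
Lemma abs_unif_lt1 : abs pi < 1. Proof. by case: hpi. Qed.
Hint Resolve unif_neq0 abs_unif_gt0 abs_unif_lt1 : core.

Lemma abs_lt1 x : abs x < 1 -> abs x <= abs pi.
Proof.
case: hpi => _ _ h /h[y hy ->]; rewrite absM // -[leRHS]mulr1.
by rewrite ler_wpM2l ?abs_ge0.
Qed.

Lemma unifXz_gt0 (k : int) : 0 < abs pi ^ k. Proof. exact: exprz_gt0. Qed.

Lemma ler_unifXz (j k : int) : j <= k -> abs pi ^ k <= abs pi ^ j.
Proof.
move=> jk; have -> : k = j + (k - j) by ring.
have : 0 <= k - j by rewrite subr_ge0.
case: (k - j) => // n _.
rewrite expfzDr ?gt_eqF // -[leRHS]mulr1 ler_wpM2l // ?(ltW (unifXz_gt0 _)) //.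
by rewrite -exprnP exprn_ile1 // ltW.
Qed.

(** The absolute value takes no value strictly between two consecutive powers
    of [abs pi]. *)
Lemma abs_discrete t (k : int) :
  abs pi ^ (k + 1) < abs t -> abs pi ^ k <= abs t.
Proof.
move=> h; have t0 : 0 < abs t by apply: le_lt_trans h; rewrite ltW ?unifXz_gt0.
have : abs (pi ^ (k + 1) / t) < 1 by rewrite absf // absXz // ltr_pdivrMr ?mul1r.
move/abs_lt1; rewrite absf // absXz // ler_pdivrMr // expfzDr ?gt_eqF //.
by rewrite expr1z mulrC ler_pM2l.
Qed.

Lemma ideal_powP n x : ideal_pow abs pi n x <-> abs x <= abs pi ^+ n.
Proof.
split=> [[y hy ->]|h].
  rewrite absM // !exprnP absXz // -[leRHS]mulr1 ler_wpM2l //.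
  by rewrite ltW ?unifXz_gt0.
exists (x / pi ^+ n); last by rewrite mulrC divfK ?expf_neq0.
rewrite /integer /= absf // exprnP absXz // ler_pdivrMr ?mul1r //.
exact: unifXz_gt0.
Qed.

Lemma unif_pow_lt (r : R) : 0 < r -> exists n, abs pi ^+ n < r.
Proof.
move=> r0; pose h := (abs pi)^-1 - 1.
have h0 : 0 < h by rewrite subr_gt0 invf_gt1.
(* Bernoulli's inequality *)
have bern n : 1 + h * n%:R <= (abs pi)^-1 ^+ n.
  elim: n => [|n IH]; first by rewrite mulr0 addr0 expr0.
  rewrite exprS; have {1}-> : (abs pi)^-1 = 1 + h by rewrite addrC subrK.
  apply: le_trans (_ : (1 + h) * (1 + h * n%:R) <= _).
    rewrite -subr_ge0 -natr1.
    have -> : (1 + h) * (1 + h * n%:R) - (1 + h * (n%:R + 1)) = h * (h * n%:R).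
      by ring.
    by rewrite !mulr_ge0 ?(ltW h0).
  by rewrite ler_pM2l // ltr_pwDl // ltW.
pose x := r^-1 / h; have x0 : 0 <= x by rewrite divr_ge0 ?invr_ge0 ?ltW.
exists (Num.bound x); rewrite -ltf_pV2 ?posrE ?exprn_gt0 // -exprVn.
apply: lt_le_trans (bern _); apply: le_lt_trans (_ : h * x < _).
  by rewrite /x mulrC divfK ?gt_eqF.
by apply: ltr_pwDl => //; rewrite ler_pM2l // ltW // archi_boundP.
Qed.

End Uniformizer.

(** * Tilings of balls *)

Section Balls.
Variables (R : realType) (F : fieldType) (abs : F -> R).
Hypothesis habs : nonarch_abs abs.
Variable pi : F.
Hypothesis hpi : uniformizer abs pi.
Variable q : nat.
Hypothesis hq : residue_card abs q.

(** Digits: an integer is congruent to a representative of its residue class,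
    and the difference is [pi] times an integer. *)
Lemma cover_integers n : exists s : seq F,
  forall t, abs t <= 1 -> exists2 c, c \in s & abs (t - c) <= abs pi ^+ n.
Proof.
have [red [redS redE]] := hq.
have /boolp.choice[d hd] (k : 'I_q) : exists y, abs y <= 1 /\ red y = k.
  by have [y hy <-] := redS k; exists y.
elim: n => [|n [s hs]].
  by exists [:: 0] => t ht; exists 0; rewrite ?inE // subr0 expr0.
exists [seq d k + pi * c | k <- enum 'I_q, c <- s] => t ht.
have [hd1 hd2] := hd (red t).
have : abs (t - d (red t)) < 1 by apply/redE.
have [pi0 _ hdiv] := hpi.
move=> /hdiv[y hy ty]; have [c cs hc] := hs _ hy.
exists (d (red t) + pi * c); first by apply: allpairs_f; rewrite ?mem_enum.
have -> : t - (d (red t) + pi * c) = pi * (y - c).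
  by rewrite mulrBr -ty opprD addrA.
by rewrite absM // exprS ler_pM2l // (abs_unif_gt0 habs hpi).
Qed.

(** Two closed balls of the same radius are equal or disjoint, so dropping the
    centres of repeated balls from a covering leaves a partition. *)
Lemma prune_cover (rho : R) (s : seq F) : 0 <= rho -> exists s' : seq F,
  [/\ uniq s', {subset s' <= s},
      {in s' &, forall c c', abs (c - c') <= rho -> c = c'} &
      forall c, c \in s -> exists2 c', c' \in s' & abs (c - c') <= rho].
Proof.
move=> rho0; have refl c : abs (c - c) <= rho by rewrite subrr abs0.
elim: s => [|x s [s' [us ss hs cs]]]; first by exists [::].
have [/hasP[c' c's h]|/hasPn h] := boolP (has (fun c => abs (x - c) <= rho) s').
  exists s'; split=> //; first by move=> c /ss; rewrite inE orbC => ->.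
  by move=> c; rewrite inE => /orP[/eqP->|/cs //]; exists c'.
exists (x :: s'); split.
- by rewrite /= us andbT; apply/negP => /h; rewrite refl.
- by move=> c; rewrite !inE => /orP[->//|/ss ->]; rewrite orbT.
- move=> c c'; rewrite !inE => /orP[/eqP->|cs'] /orP[/eqP->|c's'] //.
  + by move=> hc; case/negP: (h _ c's').
  + by rewrite absB // => hc; case/negP: (h _ cs').
  + exact: hs.
- move=> c; rewrite inE => /orP[/eqP->|/cs[c' h1 h2]].
    by exists x; rewrite ?inE ?eqxx.
  by exists c'; rewrite // inE h1 orbT.
Qed.

(** The two non-trivial conditions make every point of the large ball lie in
    exactly one of the small ones. The ball of radius [r] need not have a power
    of [abs pi] as radius: it is covered from the ball of radius
    [abs pi ^- N], and the centres outside it are discarded. *)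
Lemma tile_ball (r rho : R) : 0 < rho -> rho <= r -> exists s : seq F,
  [/\ uniq s, forall c, c \in s -> abs c <= r,
      {in s &, forall c c', abs (c - c') <= rho -> c = c'} &
      forall t, abs t <= r -> exists2 c, c \in s & abs (t - c) <= rho].
Proof.
move=> rho0 rho_r; have r0 := lt_le_trans rho0 rho_r.
have pi0 := unif_neq0 hpi; have P0 := abs_unif_gt0 habs hpi.
have [N] := unif_pow_lt habs hpi (eqbRL (invr_gt0 r) r0).
rewrite -ltf_pV2 ?posrE ?invr_gt0 ?exprn_gt0 // invrK => hN.
have [n hn] := unif_pow_lt habs hpi (mulr_gt0 rho0 (exprn_gt0 N P0)).
have [s0 hs0] := cover_integers n.
pose s1 := [seq c <- [seq c / pi ^+ N | c <- s0] | abs c <= r].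
have [s [us ss hs cs]] := prune_cover s1 (ltW rho0).
exists s; split=> //; first by move=> c /ss; rewrite mem_filter => /andP[].
move=> t ht; have aN : abs (pi ^+ N) = abs pi ^+ N by rewrite !exprnP absXz.
have [c cs0 hc] : exists2 c, c \in s0 & abs (t * pi ^+ N - c) <= abs pi ^+ n.
  apply: hs0; rewrite absM // aN -ler_pdivlMr ?exprn_gt0 // div1r.
  exact: le_trans ht (ltW hN).
have tc : abs (t - c / pi ^+ N) <= rho.
  have -> : t - c / pi ^+ N = (t * pi ^+ N - c) / pi ^+ N.
    by rewrite mulrBl mulfK ?expf_neq0.
  rewrite absf // aN ler_pdivrMr ?exprn_gt0 //.
  exact: le_trans hc (ltW hn).
have [|c' c's hc'] := cs (c / pi ^+ N).
  rewrite mem_filter (map_f (fun c => c / pi ^+ N)) // andbT.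
  have -> : c / pi ^+ N = t - (t - c / pi ^+ N) by rewrite subKr.
  by apply: absB_le => //; apply: le_trans tc rho_r.
exists c' => //; have -> : t - c' = (t - c / pi ^+ N) + (c / pi ^+ N - c').
  by rewrite addrA subrK.
exact: absD_le.
Qed.

(** Exactly one tile contains [t], so a single term survives. *)
Lemma sum_tiles (C : nmodType) (G : F -> C) (r rho : R) (s : seq F) :
    0 < rho -> uniq s ->
    {in s &, forall c c', abs (c - c') <= rho -> c = c'} ->
    (forall t, abs t <= r -> exists2 c, c \in s & abs (t - c) <= rho) ->
    (forall t c, abs (t - c) <= rho -> G t = G c) ->
  forall t, abs t <= r -> \sum_(c <- s | abs (t - c) <= rho) G c = G t.
Proof.
move=> rho0 us hs cs hG t ht; have [c c_s tc] := cs t ht.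
rewrite big_mkcond (bigD1_seq c) //= tc big_seq_cond big1 ?addr0 ?(hG t c) //.
move=> c' /andP[c's c'c]; case: ifP => // tc'.
case/eqP: c'c; apply: hs => //.
have -> : c' - c = (t - c) - (t - c') by ring.
exact: absB_le.
Qed.

(** Multiplication by a unit permutes the tiles. It does not permute the chosen
    centres, which is why the sum is expanded over the tiles and exchanged. *)
Lemma sum_tiles_scale (C : nmodType) (G : F -> C) (r rho : R) (s : seq F) a :
    0 < rho -> uniq s -> abs a = 1 ->
    (forall c, c \in s -> abs c <= r) ->
    {in s &, forall c c', abs (c - c') <= rho -> c = c'} ->
    (forall t, abs t <= r -> exists2 c, c \in s & abs (t - c) <= rho) ->
    (forall t c, abs (t - c) <= rho -> G t = G c) ->
  \sum_(c <- s) G (c * a) = \sum_(c <- s) G c.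
Proof.
move=> rho0 us a1 sr hs cs hG.
have a0 : a != 0 by rewrite -(abs_eq0 habs) a1 oner_eq0.
transitivity (\sum_(c <- s) \sum_(c' <- s | abs (c * a - c') <= rho) G c').
  rewrite big_seq [RHS]big_seq; apply: eq_bigr => c /sr hc.
  by rewrite (sum_tiles rho0 us hs cs hG) // absM // a1 mulr1.
under eq_bigr do rewrite big_mkcond.
rewrite exchange_big /= big_seq [RHS]big_seq; apply: eq_bigr => c' c's.
have hc' : abs (c' / a) <= r by rewrite absf // a1 divr1 sr.
rewrite -[RHS](sum_tiles rho0 us hs cs (G := fun=> G c') _ hc') // -big_mkcond.
apply: eq_bigl => c.
have -> : c' / a - c = - ((c * a - c') / a).
  by rewrite mulrBl mulfK // opprB.
by rewrite absN // absf // a1 divr1.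
Qed.

End Balls.

(** * Matrices of size two *)

Section GL2Calculus.
Variable F : fieldType.
Implicit Types (g h : GL2 F) (a b c d s t : F).

Lemma ord2P (P : 'I_2 -> Prop) : P 0 -> P 1 -> forall i, P i.
Proof.
by move=> P0 P1 [[|[|//]] hi]; [move: P0|move: P1]; congr P; apply: val_inj.
Qed.

Lemma sum_ord2 (M : nmodType) (f : 'I_2 -> M) : \sum_i f i = f 0 + f 1.
Proof. by rewrite !big_ord_recl big_ord0 addr0; congr (_ + f _); apply: val_inj. Qed.

Lemma gl2P g h : g 0 0 = h 0 0 -> g 0 1 = h 0 1 -> g 1 0 = h 1 0 ->
  g 1 1 = h 1 1 -> g = h.
Proof.
move=> h00 h01 h10 h11; apply: val_inj => /=; apply/matrixP.
by apply: ord2P; apply: ord2P.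
Qed.

Lemma gl2_mulE g h i j : (g * h)%g i j = g i 0 * h 0 j + g i 1 * h 1 j.
Proof. by rewrite /= mxE sum_ord2. Qed.

Lemma gl2_1E i j : (1%g : GL2 F) i j = (i == j)%:R.
Proof. by rewrite /= mxE. Qed.

Definition gl2_det g := g 0 0 * g 1 1 - g 0 1 * g 1 0.

Lemma gl2_det_neq0 g : gl2_det g != 0.
Proof.
have := gl2_unit g; rewrite unitmxE unitfE.
rewrite (expand_det_row _ 0) sum_ord2 /cofactor !det_mx11 !mxE /=.
suff -> : lift 0 0 = 1 :> 'I_2.
  suff -> : lift 1 0 = 0 :> 'I_2.
    by rewrite /= addn0 expr0 mul1r expr1 mulN1r mulrN.
  by apply: val_inj.
by apply: val_inj.
Qed.

Lemma gl2_detM g h : gl2_det (g * h)%g = gl2_det g * gl2_det h.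
Proof. by rewrite /gl2_det !gl2_mulE; ring. Qed.

Definition gl2_of a b c d : GL2 F :=
  insubd (1%g : GL2 F) (\matrix_(i, j)
    (if i == 0 then (if j == 0 then a else b) else (if j == 0 then c else d))).

Lemma gl2_ofE a b c d : a * d - b * c != 0 ->
  (gl2_of a b c d 0 0 = a) * (gl2_of a b c d 0 1 = b) *
  ((gl2_of a b c d 1 0 = c) * (gl2_of a b c d 1 1 = d)).
Proof.
move=> h; suff e : gl2_mx (gl2_of a b c d) = \matrix_(i, j)
    (if i == 0 then (if j == 0 then a else b) else (if j == 0 then c else d)).
  by rewrite !e !mxE.
apply: insubdK; rewrite -topredE /= unitmxE unitfE.
rewrite (expand_det_row _ 0) sum_ord2 /cofactor !det_mx11 !mxE /=.
by rewrite addn0 expr0 mul1r expr1 mulN1r mulrN.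
Qed.

Lemma gl2_invE g : let h := (g^-1)%g in let d := gl2_det g in
  (h 0 0 = g 1 1 / d) * (h 0 1 = - g 0 1 / d) *
  ((h 1 0 = - g 1 0 / d) * (h 1 1 = g 0 0 / d)).
Proof.
move=> h d; have d0 : d != 0 := gl2_det_neq0 g.
have hdet : g 1 1 / d * (g 0 0 / d) - - g 0 1 / d * (- g 1 0 / d) != 0.
  have -> : g 1 1 / d * (g 0 0 / d) - - g 0 1 / d * (- g 1 0 / d)
      = (g 0 0 * g 1 1 - g 0 1 * g 1 0) / d ^+ 2 by field.
  by rewrite mulf_neq0 ?invr_eq0 ?expf_neq0.
suff -> : h = gl2_of (g 1 1 / d) (- g 0 1 / d) (- g 1 0 / d) (g 0 0 / d).
  exact: gl2_ofE.
apply: (@mulgI _ g); rewrite mulgV.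
by apply: gl2P; rewrite gl2_mulE gl2_1E !(gl2_ofE hdet) /=;
  apply: (mulIf d0); rewrite mulrDl !mulrA !divfK // /d /gl2_det; ring.
Qed.

Definition lower t := gl2_of 1 0 t 1.
Definition upper s := gl2_of 1 s 0 1.
Definition diag a d := gl2_of a 0 0 d.
Definition weyl := gl2_of 0 1 1 0.

Lemma lowerE t : (lower t 0 0 = 1) * (lower t 0 1 = 0) *
  ((lower t 1 0 = t) * (lower t 1 1 = 1)).
Proof. by apply: gl2_ofE; rewrite mul0r subr0 mulr1 oner_eq0. Qed.

Lemma upperE s : (upper s 0 0 = 1) * (upper s 0 1 = s) *
  ((upper s 1 0 = 0) * (upper s 1 1 = 1)).
Proof. by apply: gl2_ofE; rewrite mulr0 subr0 mulr1 oner_eq0. Qed.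

Lemma weylE : (weyl 0 0 = 0) * (weyl 0 1 = 1) *
  ((weyl 1 0 = 1) * (weyl 1 1 = 0)).
Proof. by apply: gl2_ofE; rewrite mul0r sub0r mulr1 oppr_eq0 oner_eq0. Qed.

Lemma triE a b d : a != 0 -> d != 0 ->
  (gl2_of a b 0 d 0 0 = a) * (gl2_of a b 0 d 0 1 = b) *
  ((gl2_of a b 0 d 1 0 = 0) * (gl2_of a b 0 d 1 1 = d)).
Proof. by move=> a0 d0; apply: gl2_ofE; rewrite mulr0 subr0 mulf_neq0. Qed.

Lemma diagE a d : a != 0 -> d != 0 ->
  (diag a d 0 0 = a) * (diag a d 0 1 = 0) *
  ((diag a d 1 0 = 0) * (diag a d 1 1 = d)).
Proof. exact: triE. Qed.

Lemma lowerD t t' : (lower t * lower t')%g = lower (t + t').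
Proof. by apply: gl2P; rewrite gl2_mulE !lowerE; ring. Qed.

Lemma lower0 : lower 0 = 1%g.
Proof. by apply: gl2P; rewrite lowerE gl2_1E. Qed.

Lemma weylK : (weyl * weyl)%g = 1%g.
Proof. by apply: gl2P; rewrite gl2_mulE !weylE gl2_1E /=; ring. Qed.

Lemma weyl_lower t : (weyl * lower t)%g = (upper t * weyl)%g.
Proof. by apply: gl2P; rewrite !gl2_mulE !weylE !lowerE !upperE; ring. Qed.

(** The Bruhat decomposition, with representatives of the big cell taken in
    the lower unipotent subgroup. *)
Lemma bruhat_lower g : g 1 1 != 0 ->
  g = (gl2_of (gl2_det g / g 1 1)%R (g 0 1)%R 0 (g 1 1)%R * lower (g 1 0 / g 1 1)%R)%g.
Proof.
move=> g11; have := gl2_det_neq0 g => dg.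
apply: gl2P; rewrite gl2_mulE !triE ?lowerE ?mulf_neq0 ?invr_eq0 // /gl2_det; by field.
Qed.

Lemma bruhat_weyl g : g 1 1 = 0 ->
  g = (gl2_of (g 0 1)%R (g 0 0) 0 (g 1 0)%R * weyl)%g.
Proof.
move=> g11; have := gl2_det_neq0 g; rewrite /gl2_det g11 mulr0 sub0r oppr_eq0 mulf_eq0.
case/norP=> h1 h2.
apply: gl2P; rewrite gl2_mulE !triE ?weylE //; rewrite ?g11; ring.
Qed.

Lemma gamma_expz (pi : F) (k : int) : pi != 0 ->
  expgz (gamma pi) k = diag (pi ^ (- k)) 1.
Proof.
move=> pi0; have pV0 : pi^-1 != 0 by rewrite invr_eq0.
have gE : gamma pi = diag pi^-1 1.
  rewrite /gamma /diag /gl2_of; congr insubd; apply/matrixP.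
  by apply: ord2P; apply: ord2P; rewrite !mxE.
have diagM a a' : a != 0 -> a' != 0 ->
    (diag a 1%R * diag a' 1%R)%g = diag (a * a') 1.
  move=> a0 a'0; have := oner_neq0 F => h1; have h2 := mulf_neq0 a0 a'0.
  by apply: gl2P; rewrite gl2_mulE !diagE //; ring.
have diag1 : diag 1 1 = 1%g.
  by apply: gl2P; rewrite diagE ?oner_eq0 // gl2_1E.
have pos n : (gamma pi ^+ n)%g = diag (pi ^ (- n%:Z)) 1.
  elim: n => [|n IH]; first by rewrite expg0 expr0z diag1.
  rewrite expgS IH gE diagM ?expfz_neq0 //; congr diag.
  by rewrite -exprN1 -expfzDr // ; congr (_ ^ _); rewrite -addn1 PoszD; ring.
case: k => n; first exact: pos.
rewrite /= pos NegzE opprK.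
apply: (@mulgI _ (diag (pi ^ (- n.+1%:Z)) 1)).
by rewrite mulgV diagM ?expfz_neq0 // -expfzDr // addNr expr0z diag1.
Qed.

Lemma gammaz_diag (R : realType) (V : gl2_rep R F) (pi : F) k (v : V) :
  pi != 0 -> gammaz pi k v = rep_act (diag (pi ^ (- k)) 1) v.
Proof. by move=> pi0; rewrite /gammaz gamma_expz. Qed.

End GL2Calculus.

(** * Open compact subgroups *)

Section Topology.
Variables (R : realType) (F : fieldType) (abs : F -> R).
Hypothesis habs : nonarch_abs abs.
Implicit Types (g h k : GL2 F) (H S : set (GL2 F)) (e d : R).

Definition near1 e h := forall i j, abs (h i j - (i == j)%:R) < e.

Lemma near1_le e e' h : e <= e' -> near1 e h -> near1 e' h.
Proof. by move=> ee' hh i j; apply: lt_le_trans (hh i j) ee'. Qed.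

Lemma mx_bound (A : 'M[F]_2) : exists2 M : R, 0 < M & forall i j, abs (A i j) <= M.
Proof.
exists (1 + \sum_i \sum_j abs (A i j)).
  rewrite ltr_pwDl // !sumr_ge0 // => i _; rewrite sumr_ge0 // => j _.
  exact: abs_ge0.
move=> i j; rewrite (bigD1 i) //= (bigD1 j) //=.
set s1 := \sum_(_ | _) _; set s2 := \sum_(_ | _) _.
have s1_ge0 : 0 <= s1 by apply: sumr_ge0 => *; apply: abs_ge0.
have s2_ge0 : 0 <= s2.
  by apply: sumr_ge0 => *; apply: sumr_ge0 => *; apply: abs_ge0.
by lra.
Qed.

Lemma mulmx_small (A B : 'M[F]_2) e : 0 < e -> exists2 d : R, 0 < d &
  forall X : 'M[F]_2, (forall i j, abs (X i j) < d) ->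
    forall i j, abs ((A *m X *m B) i j) < e.
Proof.
move=> e0; have [M M0 hM] := mx_bound A; have [N N0 hN] := mx_bound B.
exists (e / (M * N)) => [|X hX i j]; first by rewrite divr_gt0 ?mulr_gt0.
have small (k l : 'I_2) : abs (A i k * X k l * B l j) < e.
  rewrite !(absM habs); have [->|x0] := eqVneq (X k l) 0.
    by rewrite abs0 // mulr0 mul0r.
  have xp : 0 < abs (X k l) by rewrite abs_gt0.
  apply: le_lt_trans (_ : M * abs (X k l) * N < e).
    rewrite ler_pM ?mulr_ge0 ?(abs_ge0 habs) //.
    by rewrite ler_pM2r.
  by have := hX k l; rewrite ltr_pdivlMr ?mulr_gt0 // mulrCA mulrA.
rewrite mxE sum_ord2 !mxE !sum_ord2 !mulrDl.
by apply: absD_lt => //; apply: absD_lt.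
Qed.

(** The difference with the identity is multiplied on both sides by fixed
    matrices. *)
Lemma near1_conj g e : 0 < e -> exists2 d : R, 0 < d &
  forall k, near1 d k -> near1 e (g^-1 * k * g)%g.
Proof.
move=> e0; have [d d0 hd] := mulmx_small (g^-1)%g g e0.
exists d => // k hk i j.
have := hd (gl2_mx k - 1%:M) _ i j; rewrite mulmxBr mulmxBl mulmx1.
rewrite /= mulVmx ?gl2_unit // !mxE; apply=> {}i {}j.
by have := hk i j; rewrite !mxE.
Qed.

Lemma near1_divl g e : 0 < e -> exists2 d : R, 0 < d &
  forall h, (forall i j, abs (h i j - g i j) < d) -> near1 e (g^-1 * h)%g.
Proof.
move=> e0; have [d d0 hd] := mulmx_small (g^-1)%g 1%:M e0.
exists d => // h hh i j.
have := hd (gl2_mx h - gl2_mx g) _ i j; rewrite mulmxBr mulmxBl !mulmx1.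
rewrite /= mulVmx ?gl2_unit // !mxE; apply=> {}i {}j.
by have := hh i j; rewrite !mxE.
Qed.

Lemma open_near1 H : gl2_open abs H -> H 1%g ->
  exists2 e : R, 0 < e & forall h, near1 e h -> H h.
Proof.
move=> oH /oH[e e0 he]; exists e => // h hh; apply: he => i j.
by rewrite gl2_1E.
Qed.

Lemma open_subgroup S : S 1%g -> (forall g h, S g -> S h -> S (g * h)%g) ->
  (exists2 e : R, 0 < e & forall h, near1 e h -> S h) -> gl2_open abs S.
Proof.
move=> S1 SM [e e0 he] g Sg; have [d d0 hd] := near1_divl g e0.
exists d => // h /hd/he Sh; have -> : h = (g * (g^-1 * h))%g by rewrite mulgA mulgV mul1g.
exact: SM.
Qed.

(** An open subgroup of a compact group is compact, because the rest of the
    group is again open. *)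
Lemma setI_open_compact_subgroup H S :
    open_compact_subgroup abs H -> S 1%g ->
    (forall g h, S g -> S h -> S (g * h)%g) -> (forall g, S g -> S g^-1%g) ->
    (exists2 e : R, 0 < e & forall h, near1 e h -> S h) ->
  open_compact_subgroup abs (H `&` S)%classic.
Proof.
move=> [H1 HM HV oH cH] S1 SM SV hS; pose T := (H `&` S)%classic.
have T1 : T 1%g by [].
have TM g h : T g -> T h -> T (g * h)%g by move=> [] ? ? [] ? ?; split; auto.
have TV g : T g -> T g^-1%g by move=> [] ? ?; split; auto.
have nT : exists2 e : R, 0 < e & forall h, near1 e h -> T h.
  have [e e0 he] := hS; have [d d0 hd] := open_near1 oH H1.
  exists (Num.min e d) => [|h hh]; first by rewrite lt_min e0 d0.
  by split; [apply: hd|apply: he]; apply: near1_le hh; rewrite ge_min lexx ?orbT.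
have oT : gl2_open abs T by apply: open_subgroup.
split=> // D oD cD.
pose W := [set g | H g /\ ~ T g]%classic.
have oW : gl2_open abs W.
  move=> g [Hg nTg]; have [e e0 he] := nT; have [d d0 hd] := near1_divl g e0.
  have [d' d'0 hd'] := oH g Hg.
  exists (Num.min d d') => [|h hh]; first by rewrite lt_min d0 d'0.
  split.
    apply: hd' => i j; apply: lt_le_trans (hh i j) _.
    by rewrite ge_min lexx orbT.
  move=> Th; apply: nTg.
  have -> : g = (h * (g^-1 * h)^-1)%g.
    apply: (@mulIg _ (g^-1 * h)%g).
    by rewrite -mulgA mulVg mulg1 mulgA mulgV mul1g.
  apply: TM => //; apply/TV/he/hd => i j.
  by apply: lt_le_trans (hh i j) _; rewrite ge_min lexx.
have [||D' [D'D fD' cD']] := cH (W |` D)%classic.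
- by move=> U [->|/oD].
- move=> g Hg; have [Tg|nTg] := pselect (T g).
    by have [U DU Ug] := cD g Tg; exists U => //; right.
  by exists W => //; left.
exists (D' `\ W)%classic; split.
- by move=> U [D'U UW]; case: (D'D _ D'U).
- exact: finite_setD.
- move=> g Tg; have [U D'U Ug] := cD' g Tg.1; exists U => //; split=> // UW.
  by move: Ug; rewrite UW => -[].
Qed.

End Topology.

(** * Functions on the group that are equivariant under the Borel subgroup *)

Section InducedFunctions.
Local Open Scope complex_scope.
Variables (R : realType) (F : fieldType) (abs : F -> R).
Hypothesis habs : nonarch_abs abs.
Variables mu mu' : F -> R[i].
Hypothesis hmu : quasichar abs mu.
Hypothesis hmu' : quasichar abs mu'.
Implicit Types (f : GL2 F -> R[i]) (g h k : GL2 F) (a b d s t : F).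

Lemma quasichar_neq0 (nu : F -> R[i]) a : quasichar abs nu -> a != 0 -> nu a != 0.
Proof.
move=> hnu a0; apply/eqP => nua0; have := oner_neq0 R[i].
by rewrite -(quasichar1 hnu) -(divff a0) (quasicharM hnu) ?invr_eq0 // nua0 mul0r eqxx.
Qed.

Lemma quasicharV (nu : F -> R[i]) a : quasichar abs nu -> a != 0 ->
  nu a^-1 = (nu a)^-1.
Proof.
move=> hnu a0; apply: (mulfI (quasichar_neq0 hnu a0)).
by rewrite -(quasicharM hnu) ?invr_eq0 // !divff ?quasichar_neq0 // (quasichar1 hnu).
Qed.

(** The factor by which the diagonal matrix with entries [a] and [d] acts in the
    normalised induction. *)
Definition weight a d : R[i] := (Num.sqrt (abs (a / d)))%:C * (mu a * mu' d).

Lemma weightM a a' d d' : a != 0 -> a' != 0 -> d != 0 -> d' != 0 ->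
  weight (a * a') (d * d') = weight a d * weight a' d'.
Proof.
move=> a0 a'0 d0 d'0; rewrite /weight (quasicharM hmu) // (quasicharM hmu') //.
have -> : a * a' / (d * d') = (a / d) * (a' / d') by field; apply/andP.
rewrite (absM habs) sqrtrM ?(abs_ge0 habs) // rmorphM /=; ring.
Qed.

Lemma weight_neq0 a d : a != 0 -> d != 0 -> weight a d != 0.
Proof.
move=> a0 d0; rewrite /weight !mulf_neq0 ?(quasichar_neq0 hmu) ?(quasichar_neq0 hmu') //.
by rewrite fmorph_eq0 gt_eqF // sqrtr_gt0 abs_gt0 // mulf_neq0 ?invr_eq0.
Qed.

Lemma weight_unit a d : abs a = 1 -> abs d = 1 -> weight a d = mu a * mu' d.
Proof. by move=> a1 d1; rewrite /weight absf // a1 d1 divr1 sqrtr1 rmorph1 mul1r. Qed.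

Definition equivariant f := forall u g : GL2 F, upper_triangular u ->
  f (u * g)%g = (Num.sqrt (delta abs u))%:C * chi mu mu' u * f g.

Lemma equivariant_tri f a b d g : equivariant f -> a != 0 -> d != 0 ->
  f (gl2_of a b 0 d * g)%g = weight a d * f g.
Proof.
move=> hf a0 d0; rewrite hf; last by rewrite /upper_triangular /= triE.
by rewrite /delta /chi !triE.
Qed.

Lemma equivariant_lowerE f g : equivariant f -> g 1 1 != 0 ->
  f g = weight (gl2_det g / g 1 1) (g 1 1) * f (lower (g 1 0 / g 1 1)).
Proof.
move=> hf g11; rewrite {1}(bruhat_lower g11) equivariant_tri //.
by rewrite mulf_neq0 ?invr_eq0 ?gl2_det_neq0.
Qed.

Lemma equivariant_weylE f g : equivariant f -> g 1 1 = 0 ->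
  f g = weight (g 0 1) (g 1 0) * f (weyl F).
Proof.
move=> hf g11; rewrite {1}(bruhat_weyl g11); have := gl2_det_neq0 g.
rewrite /gl2_det g11 mulr0 sub0r oppr_eq0 mulf_eq0 => /norP[h1 h2].
by rewrite equivariant_tri.
Qed.

(** The Weyl element and the lower unipotent matrices represent all cosets of
    the Borel subgroup. *)
Lemma equivariant_ext f f' : equivariant f -> equivariant f' ->
  f (weyl F) = f' (weyl F) -> (forall t, f (lower t) = f' (lower t)) -> f = f'.
Proof.
move=> hf hf' hw hl; apply/funext => g; have [g11|g11] := eqVneq (g 1 1) 0.
  by rewrite (equivariant_weylE hf) // (equivariant_weylE hf') // hw.
by rewrite (equivariant_lowerE hf) // (equivariant_lowerE hf') // hl.
Qed.

(** On [lower t] this is the indicator of the ball of radius [rho]: with bottom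
    row [(c, d)] the coordinate [t] is [c / d], and the weight is the one that
    the decomposition [bruhat_lower] dictates. *)
Definition cell_fun (rho : R) g : R[i] :=
  if abs (g 1 0) <= rho * abs (g 1 1) then weight (gl2_det g / g 1 1) (g 1 1) else 0.

(** On [lower t] this is the inverse of [mu], up to a positive factor, on the
    circle [abs t = rho]. It is a new vector when [mu] and [mu'] are both
    ramified and [rho] is [abs pi] to the conductor of [mu']. *)
Definition annulus_fun (rho : R) g : R[i] :=
  if abs (g 1 0) == rho * abs (g 1 1) then weight (gl2_det g / g 1 0) (g 1 1) else 0.

Lemma row1_neq0 g : ~~ ((g 1 0 == 0) && (g 1 1 == 0)).
Proof.
apply/negP => /andP[/eqP h0 /eqP h1]; have := gl2_det_neq0 g.
by rewrite /gl2_det h0 h1 !mulr0 subr0 eqxx.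
Qed.

Lemma cell_supp rho g : abs (g 1 0) <= rho * abs (g 1 1) -> g 1 1 != 0.
Proof.
move=> h; apply/negP => /eqP g11; have := row1_neq0 g; move: h.
by rewrite g11 abs0 // mulr0 eqxx andbT -(abs_eq0 habs) eq_le abs_ge0 // andbT => ->.
Qed.

Lemma annulus_supp rho g : 0 < rho -> abs (g 1 0) = rho * abs (g 1 1) ->
  g 1 0 != 0 /\ g 1 1 != 0.
Proof.
move=> rho0 h; have g11 : g 1 1 != 0 by apply: (@cell_supp rho); rewrite h.
by split=> //; rewrite -(abs_eq0 habs) h mulf_neq0 ?gt_eqF // abs_gt0.
Qed.

Lemma upper_mulE (u g : GL2 F) : upper_triangular u ->
  [/\ u 0 0 != 0, u 1 1 != 0, (u * g)%g 1 0 = u 1 1 * g 1 0,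
      (u * g)%g 1 1 = u 1 1 * g 1 1 & gl2_det (u * g)%g = u 0 0 * u 1 1 * gl2_det g].
Proof.
move=> u10; have du : gl2_det u = u 0 0 * u 1 1 by rewrite /gl2_det u10 mulr0 subr0.
have := gl2_det_neq0 u; rewrite du mulf_eq0 => /norP[u00 u11].
by rewrite gl2_detM du !gl2_mulE u10 !mul0r !add0r.
Qed.

Lemma cell_equivariant rho : equivariant (cell_fun rho).
Proof.
move=> u g /(upper_mulE g)[u00 u11 e10 e11 ed].
rewrite /cell_fun e10 e11 ed !(absM habs) mulrCA ler_pM2l ?abs_gt0 //.
case: ifP => [h|_]; last by rewrite mulr0.
have g11 := cell_supp h; rewrite -/(weight (u 0 0) (u 1 1)) -weightM //.
  by congr weight; field; apply/andP.
by rewrite mulf_neq0 ?invr_eq0 ?gl2_det_neq0.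
Qed.

Lemma annulus_equivariant rho : 0 < rho -> equivariant (annulus_fun rho).
Proof.
move=> rho0 u g /(upper_mulE g)[u00 u11 e10 e11 ed].
rewrite /annulus_fun e10 e11 ed !(absM habs) mulrCA.
have au : abs (u 1 1) != 0 by rewrite abs_eq0.
rewrite (inj_eq (mulfI au)); case: eqP => [h|_]; last by rewrite mulr0.
have [g10 g11] := annulus_supp rho0 h.
rewrite -/(weight (u 0 0) (u 1 1)) -weightM //.
  by congr weight; field; apply/andP.
by rewrite mulf_neq0 ?invr_eq0 ?gl2_det_neq0.
Qed.

(** Right translation by such a matrix moves the coordinate [c / d] of a point
    of the ball inside the ball and changes the factor by values of [mu] and
    [mu'] at arguments close to [1], which are trivial. The bound on the upper right entry weakens as [rho]
    tends to [0]. *)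
Lemma cell_invariant rho eta : 0 < rho -> eta <= 1 ->
    (forall a, abs (a - 1) < eta -> mu a = 1 /\ mu' a = 1) ->
  forall k, abs (k 0 0 - 1) < eta -> abs (k 1 1 - 1) < eta ->
    abs (k 1 0) < rho * eta -> rho * abs (k 0 1) < eta ->
  forall g, cell_fun rho (g * k)%g = cell_fun rho g.
Proof.
move=> rho0 eta1 htriv k k00 k11 k10 k01 g.
have eta0 : 0 < eta by apply: le_lt_trans k00; apply: abs_ge0.
have ak00 : abs (k 0 0) = 1 by apply: abs_near1 => //; apply: lt_le_trans eta1.
have ak11 : abs (k 1 1) = 1 by apply: abs_near1 => //; apply: lt_le_trans eta1.
have k10' : abs (k 1 0) < rho.
  by apply: lt_le_trans k10 _; rewrite -[leRHS]mulr1 ler_pM2l.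
rewrite /cell_fun !gl2_mulE; set C := g 1 0; set D := g 1 1.
have [h|h] := leP (abs C) (rho * abs D); last first.
  have C0 : 0 < abs C by apply: le_lt_trans h; rewrite mulr_ge0 ?abs_ge0 ?ltW.
  have Dk : abs (D * k 1 0) < abs C.
    apply: le_lt_trans h; rewrite absM // mulrC ler_wpM2r ?abs_ge0 //.
    exact: ltW.
  have aCk : abs (C * k 0 0) = abs C by rewrite absM // ak00 mulr1.
  rewrite absD_dom ?aCk //.
  case: ifP => //; rewrite leNgt => /negP[]; rewrite mulrC -ltr_pdivlMr //.
  apply: absD_lt => //; rewrite absM // ltr_pdivlMr //; last first.
    by rewrite ak11 mulr1 mulrC.
  rewrite -mulrA -[ltRHS]mulr1 ltr_pM2l // mulrC.
  exact: lt_le_trans k01 eta1.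
have D0 : D != 0 by apply: cell_supp h.
have aD : 0 < abs D by rewrite abs_gt0.
pose w := k 1 1 + C / D * k 0 1.
have hw : abs (w - 1) < eta.
  rewrite /w addrAC; apply: absD_lt => //; rewrite absM // absf //.
  apply: le_lt_trans k01; rewrite ler_wpM2r ?abs_ge0 //.
  by rewrite ler_pdivrMr.
have aw : abs w = 1 by apply: abs_near1 => //; apply: lt_le_trans eta1.
have w0 : w != 0 by rewrite -(abs_eq0 habs) aw oner_eq0.
have eD : C * k 0 1 + D * k 1 1 = D * w by rewrite /w; field.
have hd : abs (gl2_det k - 1) < eta.
  have -> : gl2_det k - 1 = (k 0 0 - 1) * k 1 1 + (k 1 1 - 1) - k 0 1 * k 1 0.
    by rewrite /gl2_det; ring.
  apply: absD_lt => //; first by apply: absD_lt; rewrite // absM // ak11 mulr1.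
  rewrite absN // absM //.
  apply: le_lt_trans (_ : abs (k 0 1) * (rho * eta) < _).
    by rewrite ler_wpM2l ?abs_ge0 // ltW.
  rewrite mulrCA mulrA -[ltRHS]mul1r ltr_pM2r //.
  exact: lt_le_trans k01 eta1.
have ad : abs (gl2_det k) = 1 by apply: abs_near1 => //; apply: lt_le_trans eta1.
rewrite eD [abs (D * w)]absM // aw mulr1 ifT; last first.
  apply: absD_le => //; rewrite absM // ?ak00 ?mulr1 // mulrC.
  by rewrite ler_wpM2r ?abs_ge0 // ltW.
have dk0 := gl2_det_neq0 k; have dg0 := gl2_det_neq0 g.
have -> : gl2_det (g * k)%g / (D * w) = (gl2_det g / D) * (gl2_det k / w).
  by rewrite gl2_detM; field; apply/andP.
rewrite weightM ?mulf_neq0 ?invr_eq0 //.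
rewrite (@weight_unit (gl2_det k / w)) ?absf // ?ad ?aw ?divr1 //.
rewrite (quasicharM hmu) ?invr_eq0 // (quasicharV hmu) //.
have [-> _] := htriv _ hd; have [-> ->] := htriv _ hw.
by rewrite invr1 !mulr1.
Qed.

(** This is why the conductors of [mu] and [mu'] add up: on the circle
    [abs (c / d) = rho], the character [mu] sees the relative change of [c],
    which is at most [abs (k 1 0) / rho], and [mu'] that of [d], which is at
    most [rho * abs (k 0 1)]. *)
Lemma annulus_eigen rho sigma :
    0 < rho < 1 -> 0 < sigma < 1 ->
    (forall a, abs (a - 1) <= sigma -> mu a = 1) ->
    (forall a, abs (a - 1) <= rho -> mu' a = 1) ->
  forall k, abs (k 0 0) = 1 -> abs (k 0 1) <= 1 -> abs (k 1 0) <= rho * sigma ->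
    abs (k 1 1) = 1 ->
  forall g, annulus_fun rho (g * k)%g = mu (k 1 1) * mu' (k 1 1) * annulus_fun rho g.
Proof.
move=> /andP[rho0 rho1] /andP[sig0 sig1] hm hm' k k00 k01 k10 k11 g.
have unit_neq0 a : abs a = 1 -> a != 0.
  by move=> a1; rewrite -(abs_eq0 habs) a1 oner_eq0.
have ka0 := unit_neq0 _ k00; have kd0 := unit_neq0 _ k11.
have near_unit a (e : R) : e < 1 -> abs (a - 1) <= e -> abs a = 1.
  by move=> e1 ha; apply: abs_near1 => //; apply: le_lt_trans e1.
rewrite /annulus_fun !gl2_mulE; set C := g 1 0; set D := g 1 1.
have [h|h|h] := ltgtP (abs C) (rho * abs D).
- have D0 : 0 < abs D by rewrite -(pmulr_rgt0 _ rho0); apply: le_lt_trans h; apply: abs_ge0.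
  have CD : abs C < abs D by apply: lt_le_trans h _; rewrite -[leRHS]mul1r ler_pM2r // ltW.
  rewrite mulr0 ifF //; apply/eqP => E.
  have aD : abs (D * k 1 1) = abs D by rewrite absM // k11 mulr1.
  have aD' : abs (C * k 0 1 + D * k 1 1) = abs D.
    rewrite addrC absD_dom ?aD // absM //; apply: le_lt_trans CD.
    by rewrite -[leRHS]mulr1 ler_wpM2l ?abs_ge0.
  have : abs (C * k 0 0 + D * k 1 0) < rho * abs D.
    apply: absD_lt; rewrite // absM // ?k00 ?mulr1 // mulrC.
    apply: le_lt_trans (_ : rho * sigma * abs D < _).
      by rewrite ler_wpM2r ?abs_ge0.
    by rewrite -mulrA ltr_pM2l // -[ltRHS]mul1r ltr_pM2r.
  by rewrite E aD' ltxx.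
- have C0 : 0 < abs C by apply: le_lt_trans h; rewrite mulr_ge0 ?abs_ge0 ?ltW.
  rewrite mulr0 ifF //; apply/eqP => E.
  have aC : abs (C * k 0 0) = abs C by rewrite absM // k00 mulr1.
  have aC' : abs (C * k 0 0 + D * k 1 0) = abs C.
    rewrite absD_dom ?aC // absM // mulrC; apply: le_lt_trans h.
    rewrite ler_wpM2r ?abs_ge0 //; apply: le_trans k10 _.
    by rewrite -[leRHS]mulr1 ler_pM2l // ltW.
  have : abs (C * k 0 1 + D * k 1 1) < abs C / rho.
    apply: absD_lt; rewrite // absM // ltr_pdivlMr //; last by rewrite k11 mulr1 mulrC.
    rewrite -mulrA -[ltRHS]mulr1 ltr_pM2l //.
    by apply: le_lt_trans rho1; rewrite -[leRHS]mul1r ler_pM2r.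
  by rewrite ltr_pdivlMr // mulrC -E aC' ltxx.
have [C0 D0] := annulus_supp rho0 h; rewrite -/C -/D in C0 D0.
have aD : 0 < abs D by rewrite abs_gt0.
pose wC := 1 + D / C * (k 1 0 / k 0 0); pose wD := 1 + C / D * (k 0 1 / k 1 1).
have hwC : abs (wC - 1) <= sigma.
  rewrite /wC addrAC subrr add0r absM // !(absf habs) // k00 divr1.
  rewrite h invfM mulrCA divff ?gt_eqF // mulr1 mulrC ler_pdivrMr //.
  by rewrite mulrC.
have hwD : abs (wD - 1) <= rho.
  rewrite /wD addrAC subrr add0r absM // !(absf habs) // k11 divr1 h mulfK ?gt_eqF //.
  by rewrite -[leRHS]mulr1 ler_pM2l.
have eC : C * k 0 0 + D * k 1 0 = C * (k 0 0 * wC).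
  by rewrite /wC; field; apply/andP.
have eD : C * k 0 1 + D * k 1 1 = D * (k 1 1 * wD).
  by rewrite /wD; field; apply/andP.
pose wd := 1 - k 0 1 * k 1 0 / (k 0 0 * k 1 1).
have hwd : abs (wd - 1) <= sigma.
  rewrite /wd addrAC subrr add0r absN // absf // !(absM habs) // k00 k11 mulr1 divr1.
  apply: le_trans (_ : 1 * (rho * sigma) <= _); first by rewrite ler_pM ?abs_ge0.
  by rewrite mul1r -[leRHS]mul1r ler_pM2r // ltW.
have ed : gl2_det k = k 0 0 * k 1 1 * wd by rewrite /wd /gl2_det; field; apply/andP.
have awC := near_unit _ _ sig1 hwC; have awD := near_unit _ _ rho1 hwD.
have awd := near_unit _ _ sig1 hwd.
have wC0 := unit_neq0 _ awC; have wD0 := unit_neq0 _ awD.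
have wd0 := unit_neq0 _ awd.
rewrite eC eD !(absM habs C) !(absM habs D) !(absM habs (k _ _)).
rewrite k00 k11 awC awD !mulr1 h eqxx.
have dg0 := gl2_det_neq0 g.
have -> : gl2_det (g * k)%g / (C * (k 0 0 * wC)) = (gl2_det g / C) * (k 1 1 * wd / wC).
  by rewrite gl2_detM ed; field; rewrite ka0 C0 wC0.
rewrite weightM ?mulf_neq0 ?invr_eq0 //.
rewrite (@weight_unit (k 1 1 * wd / wC)) ?(absf habs) ?(absM habs) //
  ?k11 ?awd ?awC ?awD ?mulr1 ?divr1 //.
rewrite !(quasicharM hmu) ?mulf_neq0 ?invr_eq0 // (quasicharV hmu) //.
rewrite (quasicharM hmu') // !(hm _ hwC) !(hm _ hwd) (hm' _ hwD).
by rewrite invr1 !mulr1 mulrC.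
Qed.

End InducedFunctions.

(** * Integral vectors and their translates *)

Section NewVectors.
Variables (R : realType) (F : fieldType) (abs : F -> R).
Hypothesis habs : nonarch_abs abs.
Variable pi : F.
Hypothesis hpi : uniformizer abs pi.
Variable V : gl2_rep R F.
Implicit Types (g h k : GL2 F) (u v : V) (a b c d s t : F) (n : nat) (j x y z : int).
Local Notation P := (abs pi).

Let pi0 : pi != 0 := unif_neq0 hpi.
Let P0 : 0 < P := abs_unif_gt0 habs hpi.
Let Xgt0 j : 0 < P ^ j := unifXz_gt0 habs hpi j.

(** The central character only enters the equivariance through the lower right
    entry, here [1]. Requiring [k] to be triangular makes its determinant
    [k 0 0], so that at level [0] the inverse of [k] is integral too. *)
Lemma eigenspace_fixed omega n v k : central_character V omega -> v != 0 ->
    I_eigenspace abs pi omega n v ->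
    abs (k 0 0) = 1 -> abs (k 0 1) <= 1 -> abs (k 1 0) <= P ^+ n -> k 1 1 = 1 ->
    k 0 1 * k 1 0 = 0 ->
  rep_act k v = v.
Proof.
move=> hom v0 hv k00 k01 k10 k11 kk; case: n k10 hv => [|n] k10 hv.
  have dk : gl2_det k = k 0 0 by rewrite /gl2_det k11 kk mulr1 subr0.
  have k0 : k 0 0 != 0 by exact: (unit_neq0 habs).
  apply: hv.
  suff : forall i i' : 'I_2, abs (k i i') <= 1 /\ abs (k^-1%g i i') <= 1 by [].
  rewrite expr0 in k10; apply: ord2P; apply: ord2P;
    rewrite gl2_invE dk !(absf habs);
    by rewrite ?(absN habs) k00 ?k11 ?(abs1 habs) ?divr1.
rewrite hv; last first.
  split; rewrite /integer_unit /integer /= ?k00 ?k11 ?abs1 //.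
  exact/(ideal_powP habs hpi).
have := hom 1 1%g erefl v; rewrite rep_act1 k11 => hv1.
by rewrite -hv1.
Qed.

Lemma rep_actBZ g (c : R[i]) u v :
  rep_act g (u - c *: v) = rep_act g u - c *: rep_act g v.
Proof. by rewrite linearB [rep_act g (c *: v)]linearZ. Qed.

Lemma act_conj g h h' v : (h * g = g * h')%g -> rep_act h' v = v ->
  rep_act h (rep_act g v) = rep_act g v.
Proof. by move=> e hv; rewrite -rep_actM e rep_actM hv. Qed.

Lemma gammazD j j' v : gammaz pi (j + j') v = gammaz pi j (gammaz pi j' v).
Proof.
rewrite !gammaz_diag // -rep_actM; congr (rep_act _ v).
have one0 := oner_neq0 F; have X0 i := expfz_neq0 i pi0.
by apply: gl2P; rewrite gl2_mulE !diagE // ?opprD ?expfzDr //; ring.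
Qed.

Lemma gammaz_lower j c v : rep_act (lower (c * pi ^ (- j))) v = v ->
  rep_act (lower c) (gammaz pi j v) = gammaz pi j v.
Proof.
rewrite gammaz_diag //; apply: act_conj.
have one0 := oner_neq0 F; move: (pi ^ (- j)) (expfz_neq0 (- j) pi0) => w w0.
by apply: gl2P; rewrite !gl2_mulE !(diagE w0 one0) !(lowerE c) !(lowerE (c * w)); ring.
Qed.

Lemma gammaz_upper j s v : rep_act (upper (s * pi ^ j)) v = v ->
  rep_act (upper s) (gammaz pi j v) = gammaz pi j v.
Proof.
rewrite gammaz_diag //; apply: act_conj.
have one0 := oner_neq0 F; have X0 := expfz_neq0 (- j) pi0.
have e : pi ^ (- j) * (s * pi ^ j) = s.
  by rewrite mulrCA -expfzDr // addNr expr0z mulr1.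
by apply: gl2P; rewrite !gl2_mulE !(diagE X0 one0) !(upperE s)
  !(upperE (s * pi ^ j)) ?e; ring.
Qed.

Lemma gammaz_diag1 j a v : a != 0 -> rep_act (diag a 1) v = v ->
  rep_act (diag a 1) (gammaz pi j v) = gammaz pi j v.
Proof.
move=> a0; rewrite gammaz_diag //; apply: act_conj.
have one0 := oner_neq0 F; move: (pi ^ (- j)) (expfz_neq0 (- j) pi0) => w w0.
by apply: gl2P; rewrite !gl2_mulE !(diagE a0 one0) !(diagE w0 one0); ring.
Qed.

Lemma absMXz t j : abs (t * pi ^ j) = abs t * P ^ j.
Proof. by rewrite absM // absXz. Qed.

(** Translation by [gamma ^ j'] multiplies the coordinate [t] by
    [pi ^ (- j')]; this is the effect on balls. *)
Lemma le_shift t j j' : (abs (t * pi ^ (- j')) <= P ^ j) = (abs t <= P ^ (j + j')).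
Proof.
by rewrite absMXz -invr_expz ler_pdivrMr // -expfzDr // gt_eqF.
Qed.

Lemma unit_filtrationP n a : unit_filtration abs pi n a ->
  abs a = 1 /\ abs (a - 1) <= P ^+ n.
Proof.
case: n => [|n] /=; rewrite /integer_unit /= => ha.
  by rewrite expr0; split=> //; apply: absB_le; rewrite // ?ha ?abs1.
have {}ha : abs (a - 1) <= P ^+ n.+1 by apply/(ideal_powP habs hpi).
split=> //; apply: abs_near1 => //; apply: le_lt_trans ha _.
by rewrite exprn_ilt1 ?abs_ge0 ?(abs_unif_lt1 hpi).
Qed.

Lemma ramified_witness nu : ramified abs nu -> exists2 a, abs a = 1 & nu a <> 1.
Proof.
move=> hnu; apply: contrapT => h; apply: hnu => a ha.
by apply: contrapT => hna; apply: h; exists a.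
Qed.

Lemma ramified_cond nu n : ramified abs nu -> is_cond abs pi nu n -> (0 < n)%N.
Proof. by case: n => // hnu [h _]; case: hnu. Qed.

End NewVectors.

(** * Principal series in the induced model *)

Lemma scalar_lin (K : pzRingType) (U : lmodType K) (L : U -> K) : scalar L ->
  [/\ forall u v, L (u + v) = L u + L v, forall k u, L (k *: u) = k * L u & L 0 = 0].
Proof.
move=> hL; have L0 : L 0 = 0.
  have /eqP := hL 1 0 0; rewrite scaler0 addr0 mul1r -subr_eq0 opprD addrA.
  by rewrite subrr sub0r oppr_eq0 => /eqP.
split=> [u v|k u|//]; first by have := hL 1 u v; rewrite scale1r mul1r.
by have := hL k u 0; rewrite !addr0 L0 addr0.
Qed.

Lemma scalar_sum (K : pzRingType) (U : lmodType K) (L : U -> K) (I : Type)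
    (s : seq I) (k : I -> K) (w : I -> U) : scalar L ->
  L (\sum_(i <- s) k i *: w i) = \sum_(i <- s) k i * L (w i).
Proof.
move=> /scalar_lin[LD LZ L0]; elim: s => [|i s IH]; first by rewrite !big_nil.
by rewrite !big_cons LD LZ IH.
Qed.

Section Model.
Local Open Scope complex_scope.
Variables (R : realType) (F : fieldType) (abs : F -> R).
Hypothesis habs : nonarch_abs abs.
Variables mu mu' : F -> R[i].
Hypothesis hmu : quasichar abs mu.
Hypothesis hmu' : quasichar abs mu'.
Variable V : gl2_rep R F.
Variable phi : V -> GL2 F -> R[i].
Hypothesis phi_lin : forall g, scalar (fun v => phi v g).
Hypothesis phi_inj : injective phi.
Hypothesis phi_im : range phi = Ind abs (chi mu mu').
Hypothesis phi_act : forall h v g, phi (rep_act h v) g = phi v (g * h)%g.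
Hypothesis V_smooth : smooth abs V.
Implicit Types (g h k : GL2 F) (u v : V) (a b c d s t : F).

Local Notation wt := (weight abs mu mu').
Local Notation cell := (cell_fun abs mu mu').
Local Notation annulus := (annulus_fun abs mu mu').
Local Notation weyl := (weyl F).

Lemma phi_eqv v : equivariant abs mu mu' (phi v).
Proof.
have : range phi (phi v) by exists v.
by rewrite phi_im => -[].
Qed.

Lemma phi_ext u v : phi u weyl = phi v weyl ->
  (forall t, phi u (lower t) = phi v (lower t)) -> u = v.
Proof.
move=> hw hl; apply/phi_inj/(equivariant_ext (phi_eqv u)) => //.
exact: phi_eqv.
Qed.

(** The stabiliser of [f] is open, but [Ind] asks for a compact open subgroup;
    intersecting with one that fixes some vector provides it. *)
Lemma phi_surj f : equivariant abs mu mu' f ->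
  (exists2 e : R, 0 < e & forall k, near1 abs e k -> forall g, f (g * k)%g = f g) ->
  exists u, phi u = f.
Proof.
move=> hf nf; suff : range phi f by case=> u _ <-; exists u.
rewrite phi_im; split=> //; have [H0 oH0 _] := V_smooth 0.
exists (H0 `&` [set k | forall g, f (g * k)%g = f g])%classic; last by move=> g h [].
apply: setI_open_compact_subgroup => //=.
- by move=> g; rewrite mulg1.
- by move=> g h hg hh k; rewrite mulgA hh hg.
- by move=> k hk g; rewrite -(hk (g * k^-1)%g) -mulgA mulVg mulg1.
Qed.

(** The quasi-characters are locally constant because a vector of [V] is fixed
    by an open subgroup. *)
Lemma locally_trivial : (exists v, v != 0) -> exists2 eta : R, 0 < eta <= 1 &
  forall a, abs (a - 1) < eta -> mu a = 1 /\ mu' a = 1.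
Proof.
move=> [v v0]; have [g hg] : exists g, phi v g <> 0.
  apply: contrapT => h; case/eqP: v0; apply: phi_inj; apply/funext => g.
  have [_ _ ->] := scalar_lin (phi_lin g).
  by apply: contrapT => hg; apply: h; exists g.
have [H [H1 _ _ oH _] hH] := V_smooth v.
have [e e0 he] := open_near1 oH H1; have [d d0 hd] := near1_conj habs g e0.
have triv k : near1 abs d k -> upper_triangular k ->
    (Num.sqrt (delta abs k))%:C * chi mu mu' k = 1.
  move=> /hd/he/hH hk uk; apply: (mulIf (introN eqP hg)).
  rewrite mul1r -(phi_eqv v) // -[in RHS]hk phi_act !mulgA.
  by rewrite mulgV mul1g.
have one0 := oner_neq0 F.
exists (Num.min d 1) => [|a]; first by rewrite lt_min d0 ltr01 ge_min lexx orbT.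
rewrite lt_min => /andP[ad /(abs_near1 habs) a1].
have a0 : a != 0 by rewrite -(abs_eq0 habs) a1 oner_eq0.
have abs00 := abs0 habs; split.
- have := triv (diag a 1); rewrite /delta /chi /upper_triangular /= !diagE //.
  rewrite absf // a1 abs1 // divr1 sqrtr1 rmorph1 mul1r (quasichar1 hmu') mulr1.
  by apply=> //; apply: ord2P; apply: ord2P => /=; rewrite diagE ?subr0 ?subrr ?abs00.
- have := triv (diag 1 a); rewrite /delta /chi /upper_triangular /= !diagE //.
  rewrite absf // a1 abs1 // divr1 sqrtr1 rmorph1 mul1r (quasichar1 hmu) mul1r.
  by apply=> //; apply: ord2P; apply: ord2P => /=; rewrite diagE ?subr0 ?subrr ?abs00.
Qed.

Lemma weight11 : wt 1 1 = 1.
Proof. by rewrite weight_unit ?abs1 // (quasichar1 hmu) (quasichar1 hmu') mulr1. Qed.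

Lemma phi_act_lower c u :
  phi (rep_act (lower c) u) weyl = phi u weyl /\
  forall t, phi (rep_act (lower c) u) (lower t) = phi u (lower (t + c)).
Proof.
split=> [|t]; rewrite phi_act; last by rewrite lowerD.
by rewrite weyl_lower (equivariant_tri _ _ (phi_eqv u)) ?oner_neq0 // weight11 mul1r.
Qed.

Lemma phi_act_diag1 a u : a != 0 ->
  phi (rep_act (diag a 1) u) weyl = wt 1 a * phi u weyl /\
  forall t, phi (rep_act (diag a 1) u) (lower t) = wt a 1 * phi u (lower (t * a)).
Proof.
move=> a0; have one0 := oner_neq0 F; split=> [|t]; rewrite phi_act.
  rewrite -(equivariant_tri 0 _ (phi_eqv u)) //; congr (phi u _).
  by apply: gl2P; rewrite !gl2_mulE !diagE // ?triE // !weylE; ring.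
rewrite -(equivariant_tri 0 _ (phi_eqv u)) //; congr (phi u _).
by apply: gl2P; rewrite !gl2_mulE !diagE // ?triE // !lowerE; ring.
Qed.

Lemma phi_act_weyl u : phi (rep_act weyl u) weyl = phi u (lower 0) /\
  forall t, t != 0 ->
    phi (rep_act weyl u) (lower t) = wt (- t^-1) t * phi u (lower t^-1).
Proof.
split=> [|t t0]; rewrite phi_act; first by rewrite weylK lower0.
have e10 : (lower t * weyl)%g 1 0 = 1 by rewrite gl2_mulE !lowerE !weylE; ring.
have e11 : (lower t * weyl)%g 1 1 = t by rewrite gl2_mulE !lowerE !weylE; ring.
rewrite (equivariant_lowerE (phi_eqv u)) e11 // e10 div1r.
rewrite gl2_detM; congr (_ * _); congr weight.
by rewrite /gl2_det !lowerE !weylE; field.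
Qed.

Lemma cell_weyl (rho : R) : cell rho weyl = 0.
Proof. by rewrite /cell_fun !weylE abs0 // abs1 // mulr0 ler10. Qed.

Lemma cell_lower (rho : R) t : cell rho (lower t) = (abs t <= rho)%R%:R.
Proof.
rewrite /cell_fun /gl2_det !lowerE abs1 // mulr1; case: ifP => // _.
by rewrite mul0r subr0 mulr1 divr1 weight11.
Qed.

(** In [cell_invariant] the upper right entry only counts through its product
    with [rho], so the bound [Y] on [s] is arbitrary. *)
Lemma cell_exists (Y : R) : (exists v, v != 0) -> 0 < Y ->
  exists2 rho1 : R, 0 < rho1 & forall rho, 0 < rho -> rho <= rho1 ->
    exists2 e, phi e = cell rho &
      forall s, abs s <= Y -> rep_act (upper s) e = e.
Proof.
move=> V0 Y0; have [eta /andP[eta0 eta1] htriv] := locally_trivial V0.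
have inv := cell_invariant habs hmu hmu' _ eta1 htriv.
exists (eta / (Y + 1)) => [|rho rho0 hrho].
  by rewrite divr_gt0 // addr_gt0.
have [e he] : exists e, phi e = cell rho.
  apply: phi_surj; first exact: cell_equivariant.
  exists (Num.min eta (Num.min (rho * eta) (eta / rho))) => [|k hk g].
    by rewrite !lt_min eta0 mulr_gt0 // divr_gt0.
  have h i j := hk i j; have {}h i j : [/\ abs (k i j - (i == j)%:R) < eta,
     abs (k i j - (i == j)%:R) < rho * eta &
     abs (k i j - (i == j)%:R) < eta / rho].
    by have := h i j; rewrite !lt_min => /andP[-> /andP[-> ->]].
  have [h00 _ _] := h 0 0; have [h11 _ _] := h 1 1.
  have [_ h10 _] := h 1 0; have [_ _ h01] := h 0 1.
  move: h00 h11 h10 h01; rewrite /= !subr0 => h00 h11 h10 h01.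
  by apply: inv => //; rewrite mulrC -ltr_pdivlMr.
exists e => // s hs; apply: phi_inj; apply/funext => g.
rewrite phi_act he; apply: inv; rewrite // ?upperE ?subrr ?abs0 ?mulr_gt0 //.
apply: le_lt_trans (_ : rho * Y < _); first by rewrite ler_pM2l.
rewrite ler_pdivlMr ?addr_gt0 // in hrho; apply: lt_le_trans hrho.
by rewrite ltr_pM2l // ltrDl.
Qed.

Variable pi : F.
Hypothesis hpi : uniformizer abs pi.

(** With [G t] the value of [phi v] at [lower t], the vector [v] is the sum of
    the [G c] times the translates by [lower (- c)] of a cell, over the centres
    [c] of a tiling of the ball of radius [r] by balls on which [G] is constant.
    So [A] is the sum of the [G c]. The multiplier [kappa] comes out of this
    sum because units permute the tiles; if it is not [1] then [A] is [0]. *)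
Lemma collapse v (r : R) : 0 < r -> phi v weyl = 0 ->
    (forall t, r < abs t -> phi v (lower t) = 0) ->
    (exists q, residue_card abs q) ->
  exists2 rho1 : R, 0 < rho1 & forall rho e, 0 < rho -> rho <= rho1 ->
    phi e = cell rho -> exists2 A : R[i],
      forall L : V -> R[i], scalar L ->
        (forall c u, abs c <= r -> L (rep_act (lower c) u) = L u) ->
        L v = A * L e
    & forall a kappa, abs a = 1 ->
        (forall t, phi v (lower (t * a)) = kappa * phi v (lower t)) ->
        A = kappa * A.
Proof.
move=> r0 vw vfar [q hq]; have [H [H1 _ _ oH _] hH] := V_smooth v.
have [d d0 hd] := open_near1 oH H1.
exists (Num.min r (d / 2)) => [|rho e rho0].
  by rewrite lt_min r0 divr_gt0.
rewrite le_min => /andP[rho_r rho_d] he.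
pose G t := phi v (lower t).
have Gcst t c : abs (t - c) <= rho -> G t = G c.
  move=> tc; have {}tc : abs (t - c) < d.
    apply: le_lt_trans tc _; apply: le_lt_trans rho_d _.
    by rewrite ltr_pdivrMr // ltr_pMr // ltr1n.
  rewrite /G -[in RHS](hH (lower (t - c))); last first.
    apply: hd; apply: ord2P; apply: ord2P; rewrite lowerE /= ?subr0 ?subrr ?abs0 //.
  by have [_ ->] := phi_act_lower (t - c) v; rewrite addrC subrK.
have [s [us sr hs cs]] := tile_ball habs hpi hq rho0 rho_r.
have ev : v = \sum_(c <- s) G c *: rep_act (lower (- c)) e.
  apply: phi_ext.
    rewrite (scalar_sum _ _ _ (phi_lin weyl)) vw big1 // => c _.
    by have [-> _] := phi_act_lower (- c) e; rewrite he cell_weyl mulr0.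
  move=> t; rewrite (scalar_sum _ _ _ (phi_lin (lower t))).
  transitivity (\sum_(c <- s | abs (t - c) <= rho) G c); last first.
    rewrite [LHS]big_mkcond; apply: eq_bigr => c _.
    have [_ ->] := phi_act_lower (- c) e; rewrite he cell_lower.
    by case: ifP; rewrite ?mulr1 ?mulr0.
  have [tr|tr] := leP (abs t) r; first by rewrite (sum_tiles habs rho0 us hs cs).
  rewrite vfar // big_seq_cond big1 // => c /andP[/sr cr tc].
  move: tr; rewrite ltNge => /negP[]; have -> : t = (t - c) + c by rewrite subrK.
  by apply: absD_le => //; apply: le_trans rho_r.
exists (\sum_(c <- s) G c) => [L hL Linv|a kappa a1 ha].
  rewrite {1}ev (scalar_sum _ _ _ hL) mulr_suml big_seq [RHS]big_seq.
  by apply: eq_bigr => c /sr cr; rewrite Linv // absN.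
rewrite -{1}(sum_tiles_scale habs rho0 us a1 sr hs cs Gcst) mulr_sumr.
by apply: eq_bigr => c _; apply: ha.
Qed.

(** * The two test vectors *)

Variables (omega : F -> R[i]) (n m : nat).
Hypothesis V_central : central_character V omega.
Hypothesis mu'_cond : is_cond abs pi mu' m.
Implicit Types (j x y z : int).

Local Notation P := (abs pi).

Let pi0 : pi != 0 := unif_neq0 hpi.
Let P0 : 0 < P := abs_unif_gt0 habs hpi.
Let Xgt0 j : 0 < P ^ j := unifXz_gt0 habs hpi j.
Let one0 : 1 != 0 :> F := oner_neq0 F.

Lemma gammaz_far u j j' : phi u weyl = 0 ->
    (forall t, P ^ j < abs t -> phi u (lower t) = 0) ->
  phi (gammaz pi j' u) weyl = 0 /\
  forall t, P ^ (j + j') < abs t -> phi (gammaz pi j' u) (lower t) = 0.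
Proof.
move=> uw ufar; rewrite gammaz_diag //.
have X0 := expfz_neq0 (- j') pi0.
have [-> e] := phi_act_diag1 u X0.
rewrite uw mulr0; split=> // t ht; rewrite e ufar ?mulr0 //.
by rewrite ltNge le_shift // -ltNge.
Qed.

Lemma gammaz_near u j j' : (forall t, abs t <= P ^ j -> phi u (lower t) = 0) ->
  forall t, abs t <= P ^ (j + j') -> phi (gammaz pi j' u) (lower t) = 0.
Proof.
move=> unear t ht; rewrite gammaz_diag //.
have [_ ->] := phi_act_diag1 u (expfz_neq0 (- j') pi0).
by rewrite unear ?mulr0 // le_shift.
Qed.

(** For [abs t >= 1] the matrix [lower t] times an integral upper unipotent lies
    in the Borel orbit of the Weyl element. *)
Lemma upper_fixed_far u : (forall s, abs s <= 1 -> rep_act (upper s) u = u) ->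
  phi u weyl = 0 -> forall t, P ^ 1 < abs t -> phi u (lower t) = 0.
Proof.
move=> ufix uw t ht; have {}ht : 1 <= abs t by apply: (@abs_discrete _ _ _ habs _ hpi t 0).
have t0 : t != 0 by rewrite -(abs_gt0 habs) (lt_le_trans _ ht).
rewrite -(ufix (- t^-1)); last first.
  by rewrite absN // absV // invf_le1 // (lt_le_trans _ ht).
rewrite phi_act (equivariant_weylE (phi_eqv u)) ?uw ?mulr0 //.
by rewrite gl2_mulE !lowerE !upperE; field.
Qed.

Lemma lower_fixed_near u (r : R) :
    (forall t, abs t <= r -> rep_act (lower t) u = u) -> phi u (lower 0) = 0 ->
  forall t, abs t <= r -> phi u (lower t) = 0.
Proof.
move=> ufix u1 t ht; rewrite -[t]add0r.
by have [_ <-] := phi_act_lower t u; rewrite ufix.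
Qed.

(** The integral matrix with rows [(a, (a - 1) / t)] and [(0, 1)] fixes the
    Borel coset of [lower t] and acts there by [mu' a]. If [abs t > P ^ m] it is
    available for all [a] in the unit filtration of level [m - 1], on which
    [mu'] is not trivial. *)
Lemma ramified_far u : ramified abs mu' ->
    (forall a b, abs a = 1 -> abs b <= 1 -> rep_act (gl2_of a b 0 1) u = u) ->
  phi u weyl = 0 /\ forall t, P ^ m < abs t -> phi u (lower t) = 0.
Proof.
move=> ram ufix; split.
  have [a a1 ha] := ramified_witness ram.
  have a0 := unit_neq0 habs a1.
  have : phi u weyl = wt 1 a * phi u weyl.
    have [<- _] := phi_act_diag1 u a0.
    by rewrite ufix // abs0.
  rewrite weight_unit ?abs1 // (quasichar1 hmu) mul1r => e.
  apply: contrapT => /eqP uw; apply: ha.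
  by apply: (mulIf uw); rewrite mul1r -e.
move=> t ht; apply: contrapT => /eqP ut; have m0 := ramified_cond ram mu'_cond.
have [_ /(_ m.-1)] := mu'_cond; rewrite prednK // => /(_ (leqnn _)); apply.
move=> a /(unit_filtrationP habs hpi)[a1 ha]; have a0 := unit_neq0 habs a1.
have t0 : t != 0 by rewrite -(abs_gt0 habs); apply: lt_trans ht; rewrite exprn_gt0.
have {}ht : abs (a - 1) <= abs t.
  apply: le_trans ha _; rewrite exprnP; apply: (abs_discrete habs hpi).
  by rewrite addrC -intS prednK.
have : phi u (lower t) = wt 1 a * phi u (lower t).
  rewrite -{1}(ufix a ((a - 1) / t)) //; last first.
    by rewrite absf // ler_pdivrMr ?mul1r // abs_gt0.
  rewrite phi_act -(equivariant_tri ((a - 1) / t) _ (phi_eqv u)) //.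
  congr (phi u _); apply: gl2P;
    by rewrite !gl2_mulE !(lowerE t) !(triE _ a0 one0) !(triE _ one0 a0); field.
rewrite weight_unit ?abs1 // (quasichar1 hmu) mul1r => e.
by apply: (mulIf ut); rewrite mul1r -e.
Qed.

Lemma central_act k u : k 0 1 = 0 -> k 1 0 = 0 -> k 0 0 = k 1 1 ->
  rep_act k u = omega (k 0 0) *: u.
Proof.
move=> k01 k10 kk; apply: V_central; apply/matrixP; apply: ord2P; apply: ord2P;
  by rewrite !mxE ?k01 ?k10 -?kk.
Qed.

Lemma central_phi a u : a != 0 -> omega a *: u = (mu a * mu' a) *: u.
Proof.
move=> a0; rewrite -[a in omega a](diagE a0 a0).1.1 -central_act ?diagE //.
apply: phi_inj; apply/funext => g; rewrite phi_act.
have [_ -> _] := scalar_lin (phi_lin g).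
have -> : (g * diag a a = diag a a * g)%g.
  by apply: gl2P; rewrite !gl2_mulE !diagE //; ring.
rewrite (equivariant_tri _ _ (phi_eqv u)) // /weight divff // abs1 //.
by rewrite sqrtr1 rmorph1 mul1r.
Qed.

(** The matrix with rows [(a, 0)] and [(t (1 - a), 1)] acts on the Borel coset of
    [lower t] by [mu a]. A non-zero value at [lower t] with
    [abs t <= P ^ (m + 1)] would therefore make [mu] trivial on the unit
    filtration of level [n - m - 1], and then [annulus (P ^+ m)] would be a
    non-zero eigenvector of level [n - 1], against the minimality of [n]. *)
Lemma ramified_near u : ramified abs mu -> ramified abs mu' ->
    (exists v, v != 0) -> is_conductor abs pi V omega n ->
    (forall a c, abs a = 1 -> abs c <= P ^+ n -> rep_act (gl2_of a 0 c 1) u = u) ->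
  forall t, abs t <= P ^ (m%:Z + 1) -> phi u (lower t) = 0.
Proof.
move=> ram ram' V0 [_ nmin] ufix t ht; apply: contrapT => /eqP ut.
have m0 := ramified_cond ram' mu'_cond.
have triv a : abs a = 1 -> abs (a - 1) <= P ^ (n%:Z - m%:Z - 1) -> mu a = 1.
  move=> a1 ha; have a0 := unit_neq0 habs a1.
  have : phi u (lower t) = wt a 1 * phi u (lower t).
    rewrite -{1}(ufix a (t * (1 - a))) //; last first.
      rewrite absM // absB //; apply: le_trans (ler_pM _ _ ht ha) _.
      - exact: abs_ge0.
      - exact: abs_ge0.
      - rewrite -expfzDr ?gt_eqF // exprnP.
        by apply: (ler_unifXz habs hpi); lia.
    rewrite phi_act -(equivariant_tri 0 _ (phi_eqv u)) //.
    have hd : a * 1 - 0 * (t * (1 - a)) != 0 by rewrite mul0r subr0 mulr1.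
    congr (phi u _); apply: gl2P;
      rewrite !gl2_mulE !lowerE !(gl2_ofE hd) !triE //; by ring.
  rewrite weight_unit ?abs1 // (quasichar1 hmu') mulr1 => e.
  by apply: (mulIf ut); rewrite mul1r -e.
have hn : (m.+1 < n)%N.
  rewrite ltnNge; apply/negP => hn; apply: ram => a a1; apply: triv => //.
  apply: le_trans (_ : 1 <= _); first by apply: absB_le; rewrite ?a1 ?abs1.
  by rewrite -(expr0z P); apply: (ler_unifXz habs hpi); lia.
pose c := (n - m - 1)%N; have c0 : (0 < c)%N by rewrite /c; lia.
have P1 := abs_unif_lt1 hpi.
have X01 i : (0 < i)%N -> 0 < P ^+ i < 1.
  by move=> i0; rewrite exprn_gt0 //= exprn_ilt1 ?ltW // -lt0n.
have trivc a : abs (a - 1) <= P ^+ c -> mu a = 1.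
  move=> ha; apply: triv; last first.
    by move: ha; rewrite exprnP /c; congr (_ <= _ ^ _); lia.
  apply: abs_near1 => //; apply: le_lt_trans ha _.
  by have /andP[] := X01 _ c0.
have trivm a : abs (a - 1) <= P ^+ m -> mu' a = 1.
  have [h _] := mu'_cond => ha; apply: h; case: (m) m0 ha => // i _ ha.
  exact/(ideal_powP habs hpi).
have inv := annulus_eigen habs hmu hmu' (X01 _ m0) (X01 _ c0) trivc trivm.
have [w hw] : exists w, phi w = annulus (P ^+ m).
  have [eta /andP[eta0 eta1] htriv] := locally_trivial V0.
  apply: phi_surj.
    by apply: annulus_equivariant => //; have /andP[] := X01 _ m0.
  have [/andP[m_gt0 m_lt1] /andP[c_gt0 c_lt1]] := (X01 _ m0, X01 _ c0).
  exists (Num.min eta (P ^+ m * P ^+ c)) => [|k hk g].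
    by rewrite lt_min eta0 mulr_gt0.
  have h1 i i' : abs (k i i' - (i == i')%:R) < eta.
    by apply: lt_le_trans (hk i i') _; rewrite ge_min lexx.
  have h2 i i' : abs (k i i' - (i == i')%:R) < P ^+ m * P ^+ c.
    by apply: lt_le_trans (hk i i') _; rewrite ge_min lexx orbT.
  have u00 : abs (k 0 0) = 1.
    by apply: abs_near1 => //; apply: lt_le_trans (h1 0 0) eta1.
  have u11 : abs (k 1 1) = 1.
    by apply: abs_near1 => //; apply: lt_le_trans (h1 1 1) eta1.
  have := h1 0 1; have := h2 1 0; rewrite /= !subr0 => h10 h01.
  rewrite inv //; last 2 first.
  - by apply/ltW/(lt_le_trans h01).
  - exact: ltW.
  by have [-> ->] := htriv _ (h1 1 1); rewrite !mul1r.
have m_gt0 : 0 < P ^+ m by rewrite exprn_gt0.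
have pim : pi ^+ m != 0 by rewrite expf_neq0.
have w0 : w != 0.
  apply/eqP => w0; have : phi w (lower (pi ^+ m)) = 0.
    by rewrite w0; have [_ _ ->] := scalar_lin (phi_lin (lower (pi ^+ m))).
  rewrite hw /annulus_fun !lowerE abs1 // mulr1 !exprnP absXz // eqxx -!exprnP.
  by apply/eqP/weight_neq0 => //; rewrite mulf_neq0 ?invr_eq0 ?gl2_det_neq0.
case/eqP: w0; apply: (nmin n.-1); first by lia.
have -> : n.-1 = (m + c)%N by rewrite /c; lia.
rewrite -(prednK m0) addSn /= => k [k00 k01 k10 k11].
rewrite central_phi; last exact: (unit_neq0 habs).
apply: phi_inj; apply/funext => g; rewrite phi_act hw.
have [_ -> _] := scalar_lin (phi_lin g); rewrite hw; apply: inv => //.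
by rewrite -exprD -(prednK m0) addSn; apply/(ideal_powP habs hpi).
Qed.

Section Fixed.
Variable v : V.
Hypothesis v_fixed : forall k, abs (k 0 0) = 1 -> abs (k 0 1) <= 1 ->
  abs (k 1 0) <= P ^+ n -> k 1 1 = 1 -> k 0 1 * k 1 0 = 0 -> rep_act k v = v.

Let v_tri a b : abs a = 1 -> abs b <= 1 -> rep_act (gl2_of a b 0 1) v = v.
Proof.
move=> a1 hb; have a0 := unit_neq0 habs a1.
apply: v_fixed; rewrite ?triE ?mulr0 ?abs0 ?exprn_ge0 ?abs_ge0 //.
Qed.

Let v_low a c : abs a = 1 -> abs c <= P ^+ n -> rep_act (gl2_of a 0 c 1) v = v.
Proof.
move=> a1 hb; have a0 := unit_neq0 habs a1.
have hd : a * 1 - 0 * c != 0 by rewrite mul0r subr0 mulr1.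
by apply: v_fixed; rewrite ?(gl2_ofE hd) ?mul0r ?abs0.
Qed.

Let v_diag a : abs a = 1 -> rep_act (diag a 1) v = v.
Proof. by move=> a1; apply: v_tri; rewrite ?abs0. Qed.

Let v_lower c : abs c <= P ^+ n -> rep_act (lower c) v = v.
Proof. by move=> hc; apply: v_low; rewrite ?abs1. Qed.

Let v_upper s : abs s <= 1 -> rep_act (upper s) v = v.
Proof. by move=> hc; apply: v_tri; rewrite ?abs1. Qed.

Let beta_wt : beta abs pi mu' = wt 1 pi^-1.
Proof.
rewrite /beta /weight div1r invrK (quasichar1 hmu) mul1r (quasicharV hmu') //.
by rewrite invf_div.
Qed.

Let alpha_wt : alpha abs pi mu = wt pi^-1 1.
Proof.
rewrite /alpha /weight divr1 (quasichar1 hmu') mulr1 (quasicharV hmu) //.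
by rewrite absV // sqrtrV ?abs_ge0 // fmorphV invfM mulrC.
Qed.

Let gammaz1 u : gammaz pi 1 u = rep_act (diag pi^-1 1) u.
Proof. by rewrite gammaz_diag // exprN1. Qed.

Lemma test_vector1_supp x : let v' := test_vector1 abs pi mu' m x v in
  [/\ phi v' weyl = 0, forall t, P ^ x < abs t -> phi v' (lower t) = 0 &
      forall a, abs a = 1 -> rep_act (diag a 1) v' = v'].
Proof.
rewrite /test_vector1; case: asboolP => [ram|unram].
  have [vw vfar] := ramified_far ram v_tri.
  have [-> h] := @gammaz_far v m (x - m%:Z) vw vfar; split=> // [t ht|a a1].
    by apply: h; have -> : m%:Z + (x - m%:Z) = x by ring.
  by apply: (gammaz_diag1 hpi _ (unit_neq0 habs a1)); apply: v_diag.
(* The coefficient is chosen so that the value at the Weyl element vanishes. *)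
pose u := gammaz pi 1 v - beta abs pi mu' *: v.
have -> : gammaz pi x v - beta abs pi mu' *: gammaz pi (x - 1) v
    = gammaz pi (x - 1) u.
  by rewrite -{1}[x](subrK 1) (gammazD hpi (x - 1) 1) /u /gammaz rep_actBZ.
have uw : phi u weyl = 0.
  have [phiD phiZ _] := scalar_lin (phi_lin weyl).
  rewrite /u -scaleNr phiD phiZ beta_wt gammaz1.
  have pV0 : pi^-1 != 0 by rewrite invr_eq0.
  have [-> _] := phi_act_diag1 v pV0.
  by rewrite mulNr subrr.
have ufix s : abs s <= 1 -> rep_act (upper s) u = u.
  move=> hs; rewrite /u rep_actBZ v_upper // (gammaz_upper hpi) // expr1z.
  apply: v_upper; rewrite absM // mulr_ile1 ?abs_ge0 //.
  exact/ltW/(abs_unif_lt1 hpi).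
have [-> h] := gammaz_far (x - 1) uw (upper_fixed_far ufix uw).
split=> // [t ht|a a1]; first by apply: h; rewrite addrC subrK.
have a0 := unit_neq0 habs a1; apply: (gammaz_diag1 hpi _ a0).
by rewrite /u rep_actBZ (gammaz_diag1 hpi) ?v_diag.
Qed.

(** The coefficient is the one for which the value at the identity vanishes. *)
Let u2 : V := v - (alpha abs pi mu)^-1 *: gammaz pi 1 v.

Let gammaz_u2 y : gammaz pi (y - n%:Z) v
    - (alpha abs pi mu)^-1 *: gammaz pi (y - n%:Z + 1) v = gammaz pi (y - n%:Z) u2.
Proof. by rewrite (gammazD hpi (y - n%:Z) 1) /u2 /gammaz rep_actBZ. Qed.

Let u2_lower c : abs c <= P ^ (n%:Z + 1) -> rep_act (lower c) u2 = u2.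
Proof.
move=> hc; rewrite /u2 rep_actBZ v_lower; last first.
  by apply: le_trans hc _; rewrite exprnP; apply: (ler_unifXz habs hpi); lia.
by rewrite (gammaz_lower hpi) // v_lower // exprnP (le_shift habs hpi).
Qed.

Let u2_near t : abs t <= P ^ (n%:Z + 1) -> phi u2 (lower t) = 0.
Proof.
apply: lower_fixed_near; first exact: u2_lower.
have [phiD phiZ _] := scalar_lin (phi_lin (lower 0)).
have pV0 : pi^-1 != 0 by rewrite invr_eq0.
rewrite /u2 -scaleNr phiD phiZ alpha_wt gammaz1.
have [_ ->] := phi_act_diag1 v pV0.
by rewrite mul0r mulNr mulrA mulVf ?mul1r ?subrr // weight_neq0.
Qed.

Lemma test_vector2_supp y : is_conductor abs pi V omega n ->
    (exists v : V, v != 0) -> ramified abs mu' ->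
  let v' := test_vector2 abs pi mu m n y v in
  (forall t, abs t <= P ^ (y + 1) -> phi v' (lower t) = 0) /\
  forall a, abs a = 1 -> rep_act (diag a 1) v' = v'.
Proof.
move=> hn V0 ram'; rewrite /test_vector2; case: asboolP => [ram|unram].
  have h := @gammaz_near v (m%:Z + 1) (y - m%:Z) (ramified_near ram ram' V0 hn v_low).
  split=> [t ht|a a1].
    by apply: h; have -> : m%:Z + 1 + (y - m%:Z) = y + 1 by ring.
  by apply: (gammaz_diag1 hpi _ (unit_neq0 habs a1)); apply: v_diag.
rewrite gammaz_u2; split=> [t ht|a a1].
  apply: (@gammaz_near u2 (n%:Z + 1) (y - n%:Z) u2_near).
  by have -> : n%:Z + 1 + (y - n%:Z) = y + 1 by ring.
have a0 := unit_neq0 habs a1; apply: (gammaz_diag1 hpi _ a0).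
by rewrite /u2 rep_actBZ (gammaz_diag1 hpi) ?v_diag.
Qed.

(** The level of the translated new vector, namely [n + y - m] or [y + 1], is at
    most [x]. *)
Lemma test_vector2_lower x y : y + 1 <= x -> n%:Z - m%:Z <= x - y ->
  let v' := test_vector2 abs pi mu m n y v in
  forall c, abs c <= P ^ x -> rep_act (lower c) v' = v'.
Proof.
move=> hxy hnm; rewrite /test_vector2; case: asboolP => [ram|unram] c hc.
  apply: (gammaz_lower hpi); apply: v_lower.
  rewrite exprnP (le_shift habs hpi); apply: le_trans hc _.
  by apply: (ler_unifXz habs hpi); lia.
rewrite gammaz_u2; apply: (gammaz_lower hpi); apply: u2_lower.
rewrite (le_shift habs hpi); apply: le_trans hc _.
by apply: (ler_unifXz habs hpi); lia.
Qed.

End Fixed.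
End Model.

(** * Vanishing of the invariant form *)

Theorem theorem7 (R : realType)
    (p : nat) (Qp : fieldType) (absp : Qp -> R) (hQp : is_Qp p absp)
    (F : fieldExtType Qp) (abs : F -> R) (habs : normalised_abs absp abs)
    (pi : F) (hpi : uniformizer abs pi)
    (V1 V2 V3 : gl2_rep R F)
    (hV1 : irr_adm_infdim abs V1)
    (hV2 : irr_adm_infdim abs V2)
    (hV3 : irr_adm_infdim abs V3)
    (omega1 omega2 omega3 : F -> R[i])
    (homega1 : central_character V1 omega1)
    (homega2 : central_character V2 omega2)
    (homega3 : central_character V3 omega3)
    (homega : forall a : F, a != 0 -> omega1 a * omega2 a * omega3 a = 1)
    (n1 n2 n3 : nat) (v1 : V1) (v2 : V2) (v3 : V3)
    (hv1 : new_vector abs pi omega1 n1 v1)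
    (hv2 : new_vector abs pi omega2 n2 v2)
    (hv3 : new_vector abs pi omega3 n3 v3)
    (mu1 mu1' mu2 mu2' : F -> R[i])
    (hps1 : principal_series abs V1 mu1 mu1')
    (hps2 : principal_series abs V2 mu2 mu2')
    (m1 m2 : nat)
    (hm1 : is_cond abs pi mu1' m1)
    (hm2 : is_cond abs pi mu2' m2)
    (hram : ramified abs mu1 \/ ramified abs mu2')
    (x y z : int)
    (hx : m1%:Z <= x)
    (hy : m2%:Z <= y)
    (hz : z <= x - n3%:Z) (hyz : y <= z)
    (hxy : Num.max (Num.max (n1%:Z - m1%:Z) (n2%:Z - m2%:Z)) 1 <= x - y)
    (l : V1 -> V2 -> V3 -> R[i])
    (hl : invariant_form l)
    (hl0 : exists w1 w2 w3, l w1 w2 w3 <> 0) :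
  l (test_vector1 abs pi mu1' m1 x v1)
    (test_vector2 abs pi mu2 m2 n2 y v2)
    (gammaz pi z v3) = 0.
Proof.
have [ha _ [q hq _]] := habs; have one0 := oner_neq0 F.
have hq' : exists q, residue_card abs q by exists q.
have [[V10 _] [sm1 _] _] := hV1; have [[V20 _] [sm2 _] _] := hV2.
have [_ e1 v1_0] := hv1; have [c2 e2 v2_0] := hv2; have [_ e3 v3_0] := hv3.
have fix1 k := @eigenspace_fixed _ _ _ ha _ hpi _ _ _ _ k homega1 v1_0 e1.
have fix2 k := @eigenspace_fixed _ _ _ ha _ hpi _ _ _ _ k homega2 v2_0 e2.
have fix3 k := @eigenspace_fixed _ _ _ ha _ hpi _ _ _ _ k homega3 v3_0 e3.
have [hmu1 hmu1' [phi1 [lin1 inj1 im1 act1]] _ _] := hps1.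
have [hmu2 hmu2' [phi2 [lin2 inj2 im2 act2]] _ _] := hps2.
have [[tri1 tri2 tri3] linv] := hl.
move: hxy; rewrite !ge_max => /andP[/andP[_ hxy2] hxy1].
set w1 := test_vector1 _ _ _ _ _ _; set w2 := test_vector2 _ _ _ _ _ _ _.
set w3 := gammaz _ _ _.
have w3_lower c : abs c <= abs pi ^ x -> rep_act (lower c) w3 = w3.
  move=> hc; apply: (gammaz_lower hpi); apply: fix3;
    rewrite ?lowerE ?abs0 ?abs1 ?mul0r //.
  rewrite exprnP (le_shift ha hpi); apply: le_trans hc _.
  by apply: (ler_unifXz ha hpi); lia.
have w3_upper s : abs s <= abs pi ^ (- y) -> rep_act (upper s) w3 = w3.
  move=> hs; apply: (gammaz_upper hpi); apply: fix3;
    rewrite ?upperE ?abs0 ?abs1 ?mulr0 ?exprn_ge0 ?abs_ge0 //.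
  rewrite -[z]opprK (le_shift ha hpi _ 0) sub0r; apply: le_trans hs _.
  by apply: (ler_unifXz ha hpi); lia.
have w2_lower : forall c, abs c <= abs pi ^ x -> rep_act (lower c) w2 = w2.
  have hyx : y + 1 <= x by lia.
  by move=> c; apply: (test_vector2_lower ha mu2 hpi fix2 hyx hxy2).
have [w1w w1far w1diag] := test_vector1_supp ha hmu1 hmu1' lin1 im1 act1 hpi hm1 fix1 x.
have [rho1 rho1_0 coll1] := collapse ha hmu1 hmu1' lin1 inj1 im1 act1 sm1 hpi
  (unifXz_gt0 ha hpi x) w1w w1far hq'.
(* The radius must be small for the collapse of the first test vector, and for
   the cell to be fixed by the upper unipotents that sweep the second one. *)
have [rho1' rho1'_0 cell1] := cell_exists ha hmu1 hmu1' lin1 inj1 im1 act1 sm1 V10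
  (unifXz_gt0 ha hpi (- y)).
pose rho := Num.min rho1 rho1'.
have rho0 : 0 < rho by rewrite lt_min rho1_0 rho1'_0.
have [e he e_upper] : exists2 e, phi1 e = cell_fun abs mu1 mu1' rho &
    forall s, abs s <= abs pi ^ (- y) -> rep_act (upper s) e = e.
  by apply: cell1 => //; rewrite ge_min lexx orbT.
have [|A LA Ascale] := coll1 rho e rho0 _ he; first by rewrite ge_min lexx.
rewrite (LA (fun u => l u w2 w3)) //; last first.
  by move=> c u hc; rewrite -{1}(w2_lower c hc) -{1}(w3_lower c hc) linv.
have [ram1|ram2] := hram.
  have [a a1 ha1] := ramified_witness ram1.
  have a0 := unit_neq0 ha a1.
  suff -> : A = 0 by rewrite mul0r.
  have hA : A = (mu1 a)^-1 * A.
    apply: (Ascale a _ a1) => t; have := w1diag a a1 => {2}<-.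
    have [_ ->] := phi_act_diag1 im1 act1 w1 a0.
    rewrite weight_unit ?abs1 // (quasichar1 hmu1') mulr1 mulKf //.
    exact: (quasichar_neq0 hmu1).
  apply: contrapT => /eqP A0; apply: ha1; apply: invr_inj; rewrite invr1.
  by apply: (mulIf A0); rewrite mul1r -hA.
have [w2near w2diag] :=
  test_vector2_supp ha hmu2 hmu2' lin2 inj2 im2 act2 sm2 hpi homega2 hm2 fix2 y c2 V20 ram2.
(* Conjugation by the Weyl element turns the upper unipotents into lower ones. *)
pose u2 := rep_act (weyl F) w2.
have [u2w u2t] := phi_act_weyl im2 act2 w2.
have u2w0 : phi2 u2 (weyl F) = 0.
  by rewrite u2w w2near // abs0 // ltW // (unifXz_gt0 ha hpi).
have u2far t : abs pi ^ (- y) < abs t -> phi2 u2 (lower t) = 0.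
  move=> ht; have t0 : t != 0.
    by rewrite -(abs_gt0 ha); apply: lt_trans ht; apply: (unifXz_gt0 ha hpi).
  rewrite u2t // w2near ?mulr0 //; apply: contraTT ht.
  rewrite -!ltNge -leNgt => ht; have := abs_discrete ha hpi ht.
  rewrite absV // => h; rewrite -invr_expz -[abs t]invrK.
  by rewrite lef_pV2 // posrE ?invr_gt0 ?abs_gt0 ?(unifXz_gt0 ha hpi).
have [rho2 rho2_0 coll2] := collapse ha hmu2 hmu2' lin2 inj2 im2 act2 sm2 hpi
  (unifXz_gt0 ha hpi (- y)) u2w0 u2far hq'.
have [rho2' rho2'_0 cell2] := cell_exists ha hmu2 hmu2' lin2 inj2 im2 act2 sm2 V20 ltr01.
have r0 : 0 < Num.min rho2 rho2' by rewrite lt_min rho2_0 rho2'_0.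
have [|e' he' _] := cell2 _ r0; first by rewrite ge_min lexx orbT.
have [|B LB Bscale] := coll2 _ e' r0 _ he'; first by rewrite ge_min lexx.
have weylKr u : rep_act (weyl F) (rep_act (weyl F) u) = u :> V2.
  by rewrite -rep_actM weylK rep_act1.
have -> : l e w2 w3 = l e (rep_act (weyl F) u2) w3 by rewrite weylKr.
rewrite (LB (fun u => l e (rep_act (weyl F) u) w3)).
- have [a a1 ha1] := ramified_witness ram2.
  have a0 := unit_neq0 ha a1.
  suff -> : B = 0 by rewrite mul0r mulr0.
  have hB : B = mu2' a * B.
    apply: (Bscale a _ a1) => t.
    have u2d : rep_act (diag 1 a) u2 = u2.
      have w2d : rep_act (diag a 1) w2 = w2 := w2diag a a1.
      rewrite /u2 -[in RHS]w2d -!rep_actM; congr (rep_act _ w2).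
      by apply: gl2P; rewrite !gl2_mulE !(diagE a0 one0) !(diagE one0 a0) !weylE; ring.
    rewrite -[in LHS]u2d act2.
    have -> : (lower (t * a) * diag 1 a = gl2_of 1 0 0 a * lower t)%g.
      by apply: gl2P; rewrite !gl2_mulE !(diagE one0 a0) !(lowerE t)
        !(lowerE (t * a)); ring.
    rewrite (equivariant_tri _ _ (phi_eqv im2 u2)) // weight_unit ?abs1 //.
    by rewrite (quasichar1 hmu2) mul1r.
  apply: contrapT => /eqP B0; apply: ha1.
  by apply: (mulIf B0); rewrite mul1r -hB.
- by move=> c u u'; rewrite linearP tri2.
move=> s u hs; rewrite -[in RHS](linv (upper s)) e_upper // w3_upper //.
by rewrite -!rep_actM weyl_lower.
Qed.
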